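(* Let $\alpha>0$ and let $\xi$ be an $\alpha$-balanced random integer. Let $A_n$ be the $n\times n$ random skew-symmetric matrix whose entries below the diagonal are i.i.d. copies of $\xi$ (with zero diagonal), let $M_n$ be the $n\times n$ random symmetric matrix whose entries on and below the diagonal are i.i.d. copies of $\xi$, and let $L_n$ be the reduced Laplacian of an Erdős–Rényi random graph in $G(n+1,1/2)$. There exists a constant $c>0$ such that $$\mathbf P(\det(A_{2n})=0)=O(\exp(-n^c)),\qquad \mathbf P(\det(M_n)=0)=O(\exp(-n^c)),$$ and $$\mathbf P(\det(L_n)=0)=O(\exp(-n^c)).$$
   Context: A random integer $\xi$ is $\alpha$-balanced if for every prime $p$, $\max_{r\in\mathbb Z/p\mathbb Z}\mathbf P(\xi\equiv r \pmod p)\le 1-\alpha$. The constants ($c$ and the implied constants) may depend on $\alpha$ but not on $n$. The matrix $L_n$: let $x_{ij}$, $1\le i<j\le n+1$, be independent uniform random elements of $\{0,1\}$, $x_{ji}=x_{ij}$; $L_n$ is the $n\times n$ matrix with $(i,j)$ entry $x_{ij}$ for $i\ne j$ and $(i,i)$ entry $-\sum_{1\le k\le n+1,\,k\ne i}x_{ki}$. *)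

(* Defs.v *)
From HB Require Import structures.
From mathcomp Require Import all_boot all_order all_algebra.
From mathcomp Require Import all_classical all_reals all_analysis.

Set Implicit Arguments.
Unset Strict Implicit.
Unset Printing Implicit Defensive.

Import Order.TTheory GRing.Theory Num.Theory.

Local Open Scope classical_set_scope.
Local Open Scope ring_scope.

HB.instance Definition _ := isPointed.Build int 0.

HB.instance Definition _ := @isMeasurable.Build default_measure_display
  int discrete_measurable discrete_measurable0
  discrete_measurableC discrete_measurableU.

(* The maximum over the residues [r] is expressed by quantifying over [r]. *)
Definition balanced (d : measure_display) (T : measurableType d)
    (R : realType) (P : probability T R) (alpha : R) (xi : {RV P >-> int}) :
    Prop :=
  forall (p : nat) (r : 'I_p), prime p ->
    (P [set w | (xi w = r %[mod p])%Z] <= (1 - alpha)%:E)%E.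
Arguments balanced {d T R} P alpha xi.

(* Only the variables with index in [D] are constrained. *)
Definition mutually_independent (d d' : measure_display)
    (T : measurableType d) (T' : measurableType d') (R : realType)
    (P : probability T R) (I : finType) (D : {pred I})
    (X : I -> {RV P >-> T'}) : Prop :=
  forall (J : {set I}) (B : I -> set T'), J \subset D ->
    (forall i, i \in J -> measurable (B i)) ->
    P (\bigcap_(i in [set` J]) (X i @^-1` B i)) =
    (\prod_(i in J) P (X i @^-1` B i))%E.
Arguments mutually_independent {d d' T T' R} P {I} D X.

Definition same_law (d0 d d' : measure_display)
    (T0 : measurableType d0) (T : measurableType d) (T' : measurableType d')
    (R : realType) (P0 : probability T0 R) (P : probability T R)
    (X0 : {RV P0 >-> T'}) (X : {RV P >-> T'}) : Prop :=
  forall B : set T', measurable B -> distribution P X B = distribution P0 X0 B.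
Arguments same_law {d0 d d' T0 T T' R} P0 P X0 X.

Definition iid_copies (d0 d d' : measure_display)
    (T0 : measurableType d0) (T : measurableType d) (T' : measurableType d')
    (R : realType) (P0 : probability T0 R) (P : probability T R)
    (X0 : {RV P0 >-> T'}) (I : finType) (D : {pred I})
    (X : I -> {RV P >-> T'}) : Prop :=
  mutually_independent P D X /\ (forall i, i \in D -> same_law P0 P X0 (X i)).
Arguments iid_copies {d0 d d' T0 T T' R} P0 P X0 {I} D X.

Definition uniform_bit (d : measure_display) (T : measurableType d)
    (R : realType) (P : probability T R) (X : {RV P >-> bool}) : Prop :=
  forall b : bool, P [set w | X w = b] = (2^-1)%:E.
Arguments uniform_bit {d T R} P X.

Definition below_diag (m : nat) : {pred 'I_m * 'I_m} :=
  fun p => (p.2 < p.1)%N.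
Arguments below_diag m : clear implicits.

Definition on_or_below_diag (m : nat) : {pred 'I_m * 'I_m} :=
  fun p => (p.2 <= p.1)%N.
Arguments on_or_below_diag m : clear implicits.

Definition above_diag (m : nat) : {pred 'I_m * 'I_m} :=
  fun p => (p.1 < p.2)%N.
Arguments above_diag m : clear implicits.

(* Only the entries [x (i, j)] with [j < i] are used. *)
Definition skew_mx (m : nat) (x : 'I_m * 'I_m -> int) : 'M[int]_m :=
  \matrix_(i, j) if (j < i)%N then x (i, j)
                 else if (i < j)%N then - x (j, i) else 0.

(* Only the entries [x (i, j)] with [j <= i] are used. *)
Definition sym_mx (m : nat) (x : 'I_m * 'I_m -> int) : 'M[int]_m :=
  \matrix_(i, j) if (j <= i)%N then x (i, j) else x (j, i).

(* Symmetric extension of the edge indicators [x (i, j)], [i < j]. The diagonal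
   value is meaningless and is never used below. *)
Definition edge (m : nat) (x : 'I_m * 'I_m -> bool) (i j : 'I_m) : int :=
  (if (i < j)%N then x (i, j) else x (j, i))%:R.

(* The row and column of the last vertex are the ones removed. The sign is
   adjacency minus degree. *)
Definition reduced_laplacian (n : nat) (x : 'I_n.+1 * 'I_n.+1 -> bool) :
    'M[int]_n :=
  \matrix_(i, j)
    let i' := widen_ord (leqnSn n) i in
    let j' := widen_ord (leqnSn n) j in
    if i == j then - \sum_(k < n.+1 | k != i') edge x k i' else edge x i' j'.

(* Main.v *)
(** The matrix is reduced modulo a prime [p] of size [exp (n ^ c)], where a first
    moment suffices: a singular matrix has at least [p] kernel vectors (at least
    [p ^ 2] in the skew case, by parity of the rank), so it is enough that the
    expected number of kernel vectors is bounded (by [O(p)] in the skew case).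
    By Fourier inversion this number is at most [p ^ -n] times the sum, over
    pairs [(u, v)] of vectors, of the product of the moduli of characteristic
    functions at the values [B (w i) (w j)], where [w i = (u i, v i)] is a point
    of the plane over [F_p] and [B] is essentially a nondegenerate bilinear form.

    Keep only the factors with [j < n / 2 <= i]. For a fixed first half [a] of the
    configuration the sum over each remaining point is governed by a level set
    [T] of points [w] for which almost all the [B w (a j)] are negligible. Level
    sets double: [T - T] lies in a level set at four times the cost. Either a
    bounded number of doublings multiplies the size by a large constant, and then
    a Chernoff sample of logarithmic size from the large level set, together with
    Parseval, confines almost all the [a j] to a small set; or the level set is
    trapped in a coset of a subgroup [H] of the plane, while almost all the
    [a j] lie in a coset of the orthogonal of [H]. In the second case any
    nonconstant phase costs a constant factor for every remaining point, which
    leaves only the generic configurations, with [H = 0], and those on which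
    every phase is constant. *)

Require Import Defs.
From mathcomp Require Import all_boot all_order all_algebra.
From mathcomp Require Import zify ring lra complex.
From mathcomp Require Import all_classical all_reals all_analysis.

Set Implicit Arguments.
Unset Strict Implicit.
Unset Printing Implicit Defensive.

Import Order.TTheory GRing.Theory Num.Theory.

Local Open Scope ring_scope.

(** Write [q] for the size of the field. The sum over configurations must be of order [q ^ n]
    ([q ^ n.+1] in the skew case), and one further factor [q] would destroy the bound; the estimate
    for generic configurations alone already has order [q ^ n]. If almost all of the [m] points of
    the first half lie in a set [X] and the sum over each of the [m'] remaining points is at most
    [S], the contribution is about [#|X| ^ m * S ^ m']. As [m] and [m'] differ by at most one,
    everything depends on comparing [#|X| * S] with [q ^ 2]. Parseval and the orthogonality of
    subspaces control exactly this product, and a constant factor below one in it becomes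
    exponentially small in [n].

    This gain has to pay for a union over the possible sets [X]. A set depending on the whole
    configuration would be too expensive; hence the encoding by [O(ln q)] sample points, with
    [O(ln q)] exceptional indices. The price is [q ^ O(ln q)], so [ln q ^ 2] must be at most a small
    multiple of [n]. The exponent [c = 1/4] meets this with room for every constant. *)

(** * Additive characters *)

(* [co] and [si] are the real and imaginary parts of a nontrivial additive
   character of [F]. *)
Record additive_character (R : realType) (F : finFieldType) (co si : F -> R) :
    Prop := AdditiveCharacter {
  co0 : co 0 = 1;
  si0 : si 0 = 0;
  coN : forall x, co (- x) = co x;
  siN : forall x, si (- x) = - si x;
  coD : forall x y, co (x + y) = co x * co y - si x * si y;
  siD : forall x y, si (x + y) = co x * si y + si x * co y;
  co2D_si2 : forall x, co x ^+ 2 + si x ^+ 2 = 1;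
  sum_co : forall a, a != 0 -> \sum_t co (a * t) = 0;
  sum_si : forall a, a != 0 -> \sum_t si (a * t) = 0 }.

(** [z] is a root of [1 + X + ... + X^(p-1)], which takes the nonzero value [p] at [1]. *)
Lemma complex_root_of_unity (R : realType) (p : nat) : prime p ->
  exists2 z : R[i], z ^+ p = 1 & z != 1.
Proof.
move=> pp; have p1 := prime_gt1 pp.
have sz : size (\sum_(i < p) 'X^i : {poly R[i]}) = p.
  rewrite -(prednK (ltnW p1)) big_ord_recr /= addrC size_polyDl size_polyXn //.
  apply: leq_ltn_trans (size_sum _ _ _) _.
  by apply/bigmax_leqP => i _; rewrite size_polyXn.
have /closed_rootP[z] : size (\sum_(i < p) 'X^i : {poly R[i]}) != 1 by rewrite sz gtn_eqF.
rewrite /root horner_sum => /eqP; under eq_bigr do rewrite hornerXn.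
move=> z0; exists z.
  by apply/eqP; rewrite -subr_eq0 subrX1 z0 mulr0.
apply/eqP => z1; move: z0; rewrite z1.
under eq_bigr do rewrite expr1n.
rewrite sumr_const card_ord => /eqP.
by rewrite pnatr_eq0 -leqn0 leqNgt prime_gt0.
Qed.

(** The character is [x -> z ^ x]. Its sum over the field is invariant under multiplication by
    [chi 1 = z], which is not [1], so it vanishes. *)
Lemma exists_additive_character (R : realType) (p : nat) : prime p ->
  exists co si : 'F_p -> R, additive_character co si.
Proof.
move=> pp; have [z zp z1] := @complex_root_of_unity R p pp.
have Fp : (Zp_trunc (pdiv p)).+2 = p by rewrite Fp_cast.
pose chi (x : 'F_p) := z ^+ x.
have chiD x y : chi (x + y) = chi x * chi y.
  rewrite /chi -exprD.
  have e k : z ^+ (k %% (Zp_trunc (pdiv p)).+2) = z ^+ k by rewrite Fp expr_mod.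
  exact: (e (x + y)%N).
have chi0 : chi 0 = 1 by rewrite /chi expr0.
have nz : Normc.normc z = 1.
  have : Normc.normc z ^+ p = 1.
    rewrite -(Normc.normc1 R) -zp; elim: (p) => [|n IH]; first by rewrite !expr0 Normc.normc1.
    by rewrite !exprS IH Normc.normcM.
  move/eqP; rewrite pexpr_eq1 ?prime_gt0 //; first by move/eqP.
  by case: (z) => a b /=; rewrite sqrtr_ge0.
have nchi x : Normc.normc (chi x) = 1.
  rewrite /chi; elim: (nat_of_ord x) => [|n IH]; first by rewrite expr0 Normc.normc1.
  by rewrite exprS Normc.normcM nz IH mul1r.
have sumchi a : a != 0 -> \sum_t chi (a * t) = 0.
  move=> a0; have -> : \sum_t chi (a * t) = \sum_t chi t.
    by rewrite [RHS](reindex_inj (mulfI a0)).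
  have e : chi 1 * \sum_t chi t = \sum_t chi t.
    rewrite mulr_sumr [RHS](reindex_inj (addrI 1)).
    by apply: eq_bigr => t _; rewrite chiD.
  have c1 : chi 1 - 1 != 0 by rewrite subr_eq0 /chi expr1.
  by apply: (mulfI c1); rewrite mulr0 mulrBl mul1r e subrr.
have sqn x : complex.Re (chi x) ^+ 2 + complex.Im (chi x) ^+ 2 = 1.
  have := nchi x; case: (chi x) => a b /= h.
  by rewrite -[LHS]sqr_sqrtr ?addr_ge0 ?sqr_ge0 // h expr1n.
(* [chi (- x)] is inverse to [chi x], which has modulus one, so it is the conjugate. *)
have chiN x : chi (- x) = Complex (complex.Re (chi x)) (- complex.Im (chi x)).
  have := chiD x (- x); rewrite subrr chi0; have := sqn x.
  case: (chi x) (chi (- x)) => a b [c d] /= e [h1 h2].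
  have -> : c = a by transitivity (a * (a * c - b * d) + b * (a * d + b * c));
    [rewrite -{1}[c]mul1r -e; ring | rewrite -h1 -h2; ring].
  have -> // : d = - b by transitivity (a * (a * d + b * c) - b * (a * c - b * d));
    [rewrite -{1}[d]mul1r -e; ring | rewrite -h1 -h2; ring].
have sumE a : a != 0 ->
    \sum_t complex.Re (chi (a * t)) = 0 /\ \sum_t complex.Im (chi (a * t)) = 0.
  move=> /sumchi h; split.
    have <- : complex.Re (\sum_t chi (a * t)) = \sum_t complex.Re (chi (a * t)).
      by apply: (big_morph (@complex.Re R) (op1 := +%R)) => // -[? ?] [].
    by rewrite h.
  have <- : complex.Im (\sum_t chi (a * t)) = \sum_t complex.Im (chi (a * t)).
    by apply: (big_morph (@complex.Im R) (op1 := +%R)) => // -[? ?] [].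
  by rewrite h.
exists (fun x => complex.Re (chi x)), (fun x => complex.Im (chi x)); split => //.
- by move=> x; rewrite chiN.
- by move=> x; rewrite chiN.
- by move=> x y; rewrite chiD; case: (chi x) (chi y) => a b [].
- by move=> x y; rewrite chiD; case: (chi x) (chi y) => a b [].
- by move=> a /sumE[].
- by move=> a /sumE[].
Qed.

(** * Characteristic functions modulo a prime *)

Definition bil (F : finFieldType) (sg : F) (w x : F * F) : F :=
  w.1 * x.2 + sg * (w.2 * x.1).

Lemma bilDl (F : finFieldType) (sg : F) w w' x :
  bil sg (w + w') x = bil sg w x + bil sg w' x.
Proof. by rewrite /bil /=; ring. Qed.

Lemma bilDr (F : finFieldType) (sg : F) w x x' :
  bil sg w (x + x') = bil sg w x + bil sg w x'.
Proof. by rewrite /bil /=; ring. Qed.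

Lemma bilNl (F : finFieldType) (sg : F) w x : bil sg (- w) x = - bil sg w x.
Proof. by rewrite /bil /=; ring. Qed.

Lemma bilNr (F : finFieldType) (sg : F) w x : bil sg w (- x) = - bil sg w x.
Proof. by rewrite /bil /=; ring. Qed.

Lemma bil0l (F : finFieldType) (sg : F) x : bil sg 0 x = 0.
Proof. by rewrite /bil /=; ring. Qed.

Lemma bil0r (F : finFieldType) (sg : F) w : bil sg w 0 = 0.
Proof. by rewrite /bil /=; ring. Qed.

(* [ph] stands for the modulus of a characteristic function and [psi] for
   [1 - ph ^ 2], which satisfies a weak triangle inequality. *)
Record decay_profile (R : realType) (F : finFieldType) (alpha : R)
    (ph psi : F -> R) : Prop := DecayProfile {
  ph_ge0 : forall t, 0 <= ph t;
  ph_le_exp : forall t, ph t <= expR (- (psi t / 2));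
  ph_le_sub : forall t, ph t <= 1 - psi t / 2;
  ph0 : ph 0 = 1;
  psi_ge0 : forall t, 0 <= psi t;
  psi_le1 : forall t, psi t <= 1;
  psi0 : psi 0 = 0;
  psiN : forall t, psi (- t) = psi t;
  psiD : forall s t, psi (s + t) <= 2 * (psi s + psi t);
  sum_psi : alpha * #|F|%:R <= \sum_t psi t;
  psi_uncertainty : forall (sg : F) (A X : {set F * F}) (c : F * F -> F),
    sg != 0 ->
    (forall x, x \in X ->
       \sum_(w in A) psi (bil sg w x + c w) <= alpha / 2 * #|A|%:R) ->
    (alpha / 2) ^+ 2 * (#|X| * #|A|)%:R <= #|F|%:R ^+ 2 }.

Section CharacteristicFunction.
Variables (R : realType) (F : finFieldType) (co si : F -> R).
Hypothesis chi : additive_character co si.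
Variables (mu : F -> R) (alpha : R).
Hypotheses (alpha_gt0 : 0 < alpha) (mu_ge0 : forall r, 0 <= mu r).
Hypotheses (sum_mu : \sum_r mu r = 1) (mu_le : forall r, mu r <= 1 - alpha).

Definition char_co t := \sum_r mu r * co (r * t).
Definition char_si t := \sum_r mu r * si (r * t).
Definition char_norm t := Num.sqrt (char_co t ^+ 2 + char_si t ^+ 2).
(** This is [1 - |phi t| ^ 2] for the characteristic function [phi]: the mean of [1 - cos] for the
    difference of two independent copies. As an average of [1 - cos] it inherits inequalities
    termwise. *)
Definition char_cost t :=
  \sum_r \sum_s mu r * mu s * (1 - co ((r - s) * t)).

Lemma sum_mu2 : \sum_r \sum_s mu r * mu s = 1.
Proof.
under eq_bigr do rewrite -mulr_sumr sum_mu mulr1.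
exact: sum_mu.
Qed.

Lemma co_le1 x : co x <= 1.
Proof. by have := co2D_si2 chi x; have := sqr_ge0 (si x); nra. Qed.

Lemma char_normE t : char_norm t ^+ 2 = 1 - char_cost t.
Proof.
rewrite sqr_sqrtr ?addr_ge0 ?sqr_ge0 // -[X in _ = X - _]sum_mu2 /char_cost.
rewrite !expr2 /char_co /char_si !big_distrlr /= -big_split -sumrB /=.
apply: eq_bigr => r _; rewrite -big_split -sumrB /=; apply: eq_bigr => s _.
rewrite mulrBl (coD chi) (coN chi) (siN chi). ring.
Qed.

Lemma char_cost_ge0 t : 0 <= char_cost t.
Proof.
apply: sumr_ge0 => r _; apply: sumr_ge0 => s _.
by rewrite !mulr_ge0 ?subr_ge0 ?co_le1.
Qed.

Lemma char_cost_le1 t : char_cost t <= 1.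
Proof. by rewrite -subr_ge0 -char_normE sqr_ge0. Qed.

(** The difference of the two sides is half of [(co a + co b - 2) ^ 2 + (si a - si b) ^ 2]. *)
Lemma co_cost_sub a b : 1 - co (a + b) <= 2 * ((1 - co a) + (1 - co b)).
Proof.
rewrite (coD chi); have := co2D_si2 chi a; have := co2D_si2 chi b.
have := sqr_ge0 (co a + co b - 2); have := sqr_ge0 (si a - si b).
by nra.
Qed.

Lemma char_costD s t : char_cost (s + t) <= 2 * (char_cost s + char_cost t).
Proof.
rewrite /char_cost -big_split mulr_sumr /=; apply: ler_sum => r _.
rewrite -big_split mulr_sumr /=; apply: ler_sum => r' _.
rewrite -mulrDr mulrCA ler_wpM2l ?mulr_ge0 // mulrDr.
exact: co_cost_sub.
Qed.

Lemma sum_co_bil (sg : F) d eta l : sg != 0 -> eta != 0 -> d != 0 ->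
  \sum_x co (eta * (bil sg d x + l)) = 0.
Proof.
move=> sg0 eta0 d0.
have H (g : F * F -> R) : \sum_x g x = \sum_x1 \sum_x2 g (x1, x2).
  by rewrite pair_bigA; apply: eq_bigr => -[].
rewrite H.
under eq_bigr => x1 _.
  under eq_bigr => x2 _.
    rewrite /bil /= !mulrDr addrAC -addrA mulrA (coD chi) (mulrA eta) (mulrA (eta * sg)).
    over.
  rewrite sumrB -!mulr_suml.
  over.
rewrite /=.
have [d1|d1] := eqVneq d.1 0; last first.
  have e : eta * d.1 != 0 by rewrite mulf_neq0.
  by rewrite big1 // => x1 _; rewrite (sum_co chi e) (sum_si chi e) !mul0r subrr.
have e : eta * sg * d.2 != 0.
  rewrite !mulf_neq0 //; apply: contraNneq d0 => d2.
  by apply/eqP; rewrite [d]surjective_pairing d1 d2.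
rewrite d1 mulr0; under eq_bigr do under eq_bigr do rewrite mul0r (co0 chi).
under eq_bigr do under [X in _ - X * _]eq_bigr do rewrite mul0r (si0 chi).
rewrite /= !big1_eq sumr_const.
under eq_bigr do rewrite mul0r subr0 (coD chi).
rewrite -mulr_sumr sumrB -!mulr_sumr (sum_co chi e) (sum_si chi e).
by rewrite !mulr0 subrr mulr0.
Qed.

(** By orthogonality each pair [r != s] contributes its weight times [#|F|], and the diagonal pairs
    have total weight at most [1 - alpha]. *)
Lemma sum_char_cost : alpha * #|F|%:R <= \sum_t char_cost t.
Proof.
rewrite /char_cost exchange_big /=.
under eq_bigr do rewrite exchange_big /=.
have e r s : \sum_t mu r * mu s * (1 - co ((r - s) * t)) =
    (r != s)%:R * (mu r * mu s * #|F|%:R).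
  rewrite -mulr_sumr sumrB; have [->|rs] /= := eqVneq r s.
    by rewrite subrr; under [X in _ - X]eq_bigr do rewrite mul0r (co0 chi); rewrite subrr mulr0 mul0r.
  by rewrite (sum_co chi) ?subr_eq0 // sumr_const subr0 mul1r.
under eq_bigr do under eq_bigr do rewrite e.
under eq_bigr do under eq_bigr do rewrite mulrA.
under eq_bigr do rewrite -mulr_suml.
rewrite -mulr_suml ler_wpM2r //.
have -> : alpha = \sum_r mu r * alpha by rewrite -mulr_suml sum_mu mul1r.
apply: ler_sum => r _.
rewrite (bigD1 r) //= eqxx mul0r add0r.
under eq_bigr => s sr do rewrite eq_sym sr mul1r.
rewrite -mulr_sumr ler_wpM2l //.
have := mu_le r; have := sum_mu; rewrite (bigD1 r) //=.
by move: (\sum_(_ | _) _) => S; lra.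
Qed.

(** A product of two cosines is half the sum of the cosines of the sum and of the difference;
    summing over [x] kills all terms except [w' = - w] and [w' = w]. The surviving cosines carry the
    shifts [c] and are only bounded by one. *)
Lemma parseval_co (sg : F) (A : {set F * F}) (c : F * F -> F) eta :
    sg != 0 -> eta != 0 ->
  \sum_x (\sum_(w in A) co (eta * (bil sg w x + c w))) ^+ 2 <=
    #|F|%:R ^+ 2 * #|A|%:R.
Proof.
move=> sg0 eta0.
have cc (a b : F) : co a * co b = (co (a + b) + co (a - b)) / 2.
  by rewrite !(coD chi) (coN chi) (siN chi); field.
under eq_bigr do rewrite expr2 big_distrlr /=.
under eq_bigr do under eq_bigr do under eq_bigr do rewrite cc -mulrDr -mulrBr.
rewrite exchange_big /=; under eq_bigr do rewrite exchange_big /=.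
have key d l : \sum_x co (eta * (bil sg d x + l)) <= (d == 0)%:R * #|F|%:R ^+ 2.
  have [->|d0] /= := eqVneq d 0; last by rewrite sum_co_bil // mul0r.
  rewrite mul1r -natrX -mulnn -card_prod.
  have <- : \sum_(x : F * F) (1 : R) = #|{: F * F}|%:R by rewrite sumr_const.
  by apply: ler_sum => x _; apply: co_le1.
have key2 w w' : \sum_x (co (eta * (bil sg w x + c w + (bil sg w' x + c w'))) +
    co (eta * (bil sg w x + c w - (bil sg w' x + c w')))) / 2 <=
    ((w' == - w)%:R + (w' == w)%:R) / 2 * #|F|%:R ^+ 2.
  rewrite -mulr_suml mulrAC ler_wpM2r ?invr_ge0 // big_split /= mulrDl lerD //.
    have := key (w + w') (c w + c w'); rewrite addrC addr_eq0.
    by congr (_ <= _); apply: eq_bigr => x _; rewrite bilDl; congr (co (_ * _)); ring.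
  have := key (w - w') (c w - c w'); rewrite subr_eq0 [w == w']eq_sym.
  congr (_ <= _); apply: eq_bigr => x _; rewrite bilDl bilNl; congr (co (_ * _)); ring.
apply: (@le_trans _ _ (\sum_(w in A) \sum_(w' in A)
    (((w' == - w)%:R + (w' == w)%:R) / 2 * #|F|%:R ^+ 2))).
  by apply: ler_sum => w _; apply: ler_sum => w' _; apply: key2.
have -> : #|F|%:R ^+ 2 * #|A|%:R = \sum_(w in A) (1 * #|F|%:R ^+ 2) :> R.
  by rewrite -mulr_suml sumr_const mulrC.
apply: ler_sum => w wA; rewrite -mulr_suml ler_wpM2r ?exprn_ge0 //.
rewrite -mulr_suml ler_pdivrMr // mul1r big_split /= -[2]/(1 + 1 : R).
have h (v : F * F) : \sum_(w' in A) (w' == v)%:R <= 1 :> R.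
  have [vA|vA] := boolP (v \in A).
    by rewrite (bigD1 v) //= eqxx big1 ?addr0 // => u /andP[_ /negPf ->].
  by rewrite big1 // => u uA; case: eqVneq vA => // <-; rewrite uA.
by rewrite lerD.
Qed.

(** At a point [x] of [X] the cosine sums [Z (r - s) x], weighted over [r != s], add up to at least
    [lam], that is [alpha / 2 * #|A|]. Hence their weighted mean square is at least [lam ^ 2], while
    Parseval bounds the sum of it over all [x]. The diagonal is split off because Parseval needs a
    nonzero frequency. *)
Lemma char_uncertainty (sg : F) (A X : {set F * F}) (c : F * F -> F) :
  sg != 0 ->
  (forall x, x \in X ->
     \sum_(w in A) char_cost (bil sg w x + c w) <= alpha / 2 * #|A|%:R) ->
  (alpha / 2) ^+ 2 * (#|X| * #|A|)%:R <= #|F|%:R ^+ 2.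
Proof.
move=> sg0 hX.
have [A0|A0] := posnP #|A|; first by rewrite A0 muln0 mulr0 exprn_ge0.
pose nu r s : R := (r != s)%:R * (mu r * mu s).
pose Z eta x := \sum_(w in A) co (eta * (bil sg w x + c w)).
pose lam : R := alpha / 2 * #|A|%:R.
have nu_ge0 r s : 0 <= nu r s by rewrite /nu !mulr_ge0.
have nu_le1 : \sum_r \sum_s nu r s <= 1.
  rewrite -sum_mu2; apply: ler_sum => r _; apply: ler_sum => s _.
  by rewrite /nu ler_piMl ?mulr_ge0 //; case: (_ != _).
have diag : \sum_r mu r * mu r <= 1 - alpha.
  have -> : 1 - alpha = \sum_r mu r * (1 - alpha) by rewrite -mulr_suml sum_mu mul1r.
  by apply: ler_sum => r _; rewrite ler_wpM2l.
have lamle x : x \in X -> lam <= \sum_r \sum_s nu r s * Z (r - s) x.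
  move=> /hX; rewrite /char_cost exchange_big /=.
  under eq_bigr do rewrite exchange_big /=.
  have e r s : \sum_(w in A) mu r * mu s * (1 - co ((r - s) * (bil sg w x + c w))) =
     mu r * mu s * #|A|%:R - (nu r s * Z (r - s) x + (r == s)%:R * (mu r * mu s * #|A|%:R)).
    rewrite -mulr_sumr sumrB sumr_const mulrBr; congr (_ - _).
    rewrite /nu -/(Z (r - s) x); have [->|rs] /= := eqVneq r s; last by rewrite mul0r mul1r addr0.
    rewrite mul0r mul0r add0r mul1r /Z; congr (_ * _).
    by under eq_bigr do rewrite subrr mul0r (co0 chi); rewrite sumr_const.
  under eq_bigr do under eq_bigr do rewrite e.
  under eq_bigr do rewrite sumrB -mulr_suml big_split /=.
  rewrite sumrB big_split /= -mulr_suml sum_mu2 mul1r.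
  have -> : \sum_r \sum_s (r == s)%:R * (mu r * mu s * #|A|%:R) =
      (\sum_r mu r * mu r) * #|A|%:R.
    rewrite mulr_suml; apply: eq_bigr => r _.
    rewrite (bigD1 r) //= eqxx mul1r big1 ?addr0 // => s sr.
    by rewrite eq_sym (negPf sr) mul0r.
  have : (\sum_r mu r * mu r) * #|A|%:R <= (1 - alpha) * #|A|%:R.
    by rewrite ler_wpM2r.
  by rewrite /lam; lra.
have sqle x : x \in X -> lam ^+ 2 <= \sum_r \sum_s nu r s * Z (r - s) x ^+ 2.
  move=> /lamle h.
  (* Jensen for weights of total mass at most one, by expanding the squares around [lam]. *)
  have : 0 <= \sum_r \sum_s nu r s * (Z (r - s) x - lam) ^+ 2.
    by apply: sumr_ge0 => r _; apply: sumr_ge0 => s _; rewrite mulr_ge0 ?sqr_ge0.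
  have -> : \sum_r \sum_s nu r s * (Z (r - s) x - lam) ^+ 2 =
    \sum_r \sum_s nu r s * Z (r - s) x ^+ 2
      - 2 * lam * (\sum_r \sum_s nu r s * Z (r - s) x) + lam ^+ 2 * \sum_r \sum_s nu r s.
    rewrite !mulr_sumr -sumrB -big_split /=; apply: eq_bigr => r _.
    rewrite !mulr_sumr -sumrB -big_split /=; apply: eq_bigr => s _.
    by ring.
  have lam0 : 0 <= lam by rewrite /lam mulr_ge0 // divr_ge0 // ltW.
  have h1 : lam * lam <= lam * (\sum_r \sum_s nu r s * Z (r - s) x).
    by rewrite ler_wpM2l.
  have h2 : lam ^+ 2 * (\sum_r \sum_s nu r s) <= lam ^+ 2 * 1.
    by rewrite ler_wpM2l ?sqr_ge0.
  by rewrite expr2 in h2 *; lra.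
have : \sum_(x in X) lam ^+ 2 <= #|F|%:R ^+ 2 * #|A|%:R.
  apply: le_trans (ler_sum _ sqle) _.
  rewrite exchange_big /=; under eq_bigr do rewrite exchange_big /=.
  apply: (@le_trans _ _ (\sum_r \sum_s nu r s * (#|F|%:R ^+ 2 * #|A|%:R))).
    apply: ler_sum => r _; apply: ler_sum => s _; rewrite -mulr_sumr.
    have [->|rs] := eqVneq r s; first by rewrite /nu eqxx !mul0r.
    rewrite ler_wpM2l //.
    apply: le_trans (parseval_co A c sg0 (_ : r - s != 0)); last by rewrite subr_eq0.
    rewrite [leRHS](bigID (mem X)) /= lerDl.
    by apply: sumr_ge0 => x _; rewrite sqr_ge0.
  under eq_bigr do rewrite -mulr_suml.
  by rewrite -mulr_suml ler_piMl ?mulr_ge0 ?exprn_ge0.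
rewrite sumr_const /lam => h.
have A0' : 0 < #|A|%:R :> R by rewrite ltr0n.
rewrite -(ler_pM2r A0'); apply: le_trans h.
by rewrite -mulr_natr natrM le_eqVlt; apply/orP; left; apply/eqP; ring.
Qed.

Lemma char_decay_profile : decay_profile alpha char_norm char_cost.
Proof.
have sqrt_le (x y : R) : 0 <= y -> x ^+ 2 <= y ^+ 2 -> x <= y.
  move=> y0; have [x0 _|x0] := ltP x 0; first exact: le_trans (ltW x0) y0.
  by rewrite ler_sqr.
split.
- by move=> t; apply: sqrtr_ge0.
- move=> t; apply: sqrt_le; first exact: expR_ge0.
  rewrite char_normE -expRM_natl.
  have := expR_ge1Dx (- char_cost t).
  by congr (_ <= expR _); rewrite -mulr_natl; field.
- move=> t; have := char_cost_le1 t; have := char_cost_ge0 t => h0 h1.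
  apply: sqrt_le; first lra.
  by rewrite char_normE; nra.
- apply/eqP; rewrite -(pexpr_eq1 (n := 2)) ?sqrtr_ge0 // char_normE subr_eq addrC.
  rewrite -subr_eq subrr eq_sym; apply/eqP.
  rewrite /char_cost big1 // => r _; rewrite big1 // => s _.
  by rewrite mulr0 (co0 chi) subrr mulr0.
- exact: char_cost_ge0.
- exact: char_cost_le1.
- rewrite /char_cost big1 // => r _; rewrite big1 // => s _.
  by rewrite mulr0 (co0 chi) subrr mulr0.
- move=> t; rewrite /char_cost; apply: eq_bigr => r _; apply: eq_bigr => s _.
  by rewrite mulrN (coN chi).
- exact: char_costD.
- exact: sum_char_cost.
- exact: char_uncertainty.
Qed.

End CharacteristicFunction.

(** * Subspaces of the plane *)

Section PlaneSubspaces.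
Variable F : finFieldType.
Implicit Types (w h x : F * F) (H : {set F * F}).

Definition scl (t : F) w : F * F := (t * w.1, t * w.2).

Definition quad w : F := w.1 * w.2.

Definition subspace H : Prop :=
  0 \in H /\ forall h h' t, h \in H -> h' \in H -> h + scl t h' \in H.

(** Lines through the origin are indexed by the projective line: [None] is the vertical axis,
    [Some 0] the horizontal one. *)
Definition line_dir (o : option F) : F * F := if o is Some y then (1, y) else (0, 1).

Definition line (o : option F) : {set F * F} := [set scl t (line_dir o) | t : F].

Definition annihilator (sg : F) H : {set F * F} :=
  [set x | [forall h in H, bil sg h x == 0]].

Lemma annihilatorP (sg : F) H x :
  reflect (forall h, h \in H -> bil sg h x = 0) (x \in annihilator sg H).
Proof.
rewrite inE; apply: (iffP forall_inP) => h y yH; first exact/eqP/h.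
by apply/eqP/h.
Qed.

Lemma bil_scll (sg t : F) h x : bil sg (scl t h) x = t * bil sg h x.
Proof. by rewrite /bil /scl /=; ring. Qed.

Lemma scl1 h : scl 1 h = h.
Proof. by rewrite /scl !mul1r; case: h. Qed.

Lemma subspaceZ H t h : subspace H -> h \in H -> scl t h \in H.
Proof. by move=> [H0 HD] hH; rewrite -[scl t h]add0r HD. Qed.

Lemma subspaceD H h h' : subspace H -> h \in H -> h' \in H -> h + h' \in H.
Proof. by move=> [H0 HD] hH h'H; rewrite -[h']scl1 HD. Qed.

Lemma subspaceN H h : subspace H -> h \in H -> - h \in H.
Proof.
move=> HH /(subspaceZ (-1) HH); rewrite /scl !mulN1r.
by case: h.
Qed.

(** This is where the field has to be a prime field: every scalar is a multiple of [1], so additive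
    subgroups are subspaces. *)
Lemma subspace_closed_addr H : (forall t : F, exists k : nat, t = k%:R) ->
  0 \in H -> (forall h h', h \in H -> h' \in H -> h + h' \in H) -> subspace H.
Proof.
move=> Fnat H0 HD; split=> // h h' t hH h'H; apply: (HD) => //.
have [k ->] := Fnat t.
have -> : scl k%:R h' = h' *+ k.
  rewrite /scl !mulr_natl; elim: k => [|k IH]; first by rewrite !mulr0n.
  by rewrite !mulrS -IH; case: h' {h'H IH}.
by elim: k => [|k IH]; [rewrite mulr0n | rewrite mulrS; apply: HD].
Qed.

Lemma subspace_cases H : subspace H ->
  H = [set (0 : F * F)] \/ H = [set: F * F] \/ exists o, H = line o.
Proof.
move=> HH; have [H0 HD] := HH.
have [/exists_inP[h hH h0]|/exists_inPn Hz] := boolP [exists h in H, h != 0]; last first.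
  left; apply/setP => x; rewrite inE; apply/idP/eqP => [/Hz|->] //.
  by rewrite negbK => /eqP.
right.
have [ o [s s0 hE]] : exists o, exists2 s, s != 0 & h = scl s (line_dir o).
  have [h1|h1] := eqVneq h.1 0.
    exists None, h.2; first by apply: contraNneq h0 => h2; rewrite [h]surjective_pairing h1 h2.
    by rewrite [LHS]surjective_pairing h1 /scl /= mulr0 mulr1.
  exists (Some (h.2 / h.1)), h.1 => //.
  by rewrite [LHS]surjective_pairing /scl /= mulr1 mulrC divfK.
have dH : line_dir o \in H.
  have -> : line_dir o = scl s^-1 h.
    by rewrite hE /scl /= !mulrA mulVf // !mul1r; case: (line_dir o).
  exact: subspaceZ.
have lH x : x \in line o -> x \in H by move=> /imsetP[t _ ->]; exact: subspaceZ.
have [/fintype.subsetP Hl|/fintype.subsetPn[h2 h2H h2l]] := boolP (H \subset line o).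
  by right; exists o; apply/setP => x; apply/idP/idP => [/Hl|/lH].
left; apply/setP => w; rewrite inE.
(* A vector [h2] off the line completes its direction to a basis; [s1] and [s2] come from Cramer's
   rule, with [D0] the nonvanishing of the determinant. *)
suff [s1 [s2 ->]] : exists s1 s2, w = scl s1 (line_dir o) + scl s2 h2.
  by apply: HD => //; apply: subspaceZ.
case: o {hE dH lH} h2l => [y0|] h2l /=.
  have D0 : h2.2 - y0 * h2.1 != 0.
    apply: contra h2l; rewrite subr_eq0 => /eqP e; apply/imsetP; exists h2.1 => //.
    by rewrite /scl /= mulr1 [h2.1 * _]mulrC -e; case: (h2).
  exists (w.1 - (w.2 - y0 * w.1) / (h2.2 - y0 * h2.1) * h2.1).
  exists ((w.2 - y0 * w.1) / (h2.2 - y0 * h2.1)).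
  by rewrite [LHS]surjective_pairing; congr pair; rewrite /=; field.
have D0 : h2.1 != 0.
  apply: contra h2l => /eqP e; apply/imsetP; exists h2.2 => //.
  by rewrite /scl /= mulr1 mulr0 -e; case: (h2).
exists (w.2 - w.1 / h2.1 * h2.2), (w.1 / h2.1).
by rewrite [LHS]surjective_pairing; congr pair; rewrite /=; field.
Qed.

Lemma card_line o : #|line o| = #|F|.
Proof.
rewrite card_imset // => s t [] e1 e2.
by case: o e1 e2 => [y|] /=; rewrite ?mulr1 // => -> .
Qed.

Lemma card_annihilator (sg : F) H : sg != 0 -> subspace H ->
  (#|H| * #|annihilator sg H| <= #|F| ^ 2)%N.
Proof.
move=> sg0 /subspace_cases[->|[->|[ o ->]]].
- rewrite cards1 mul1n; apply: leq_trans (max_card _) _.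
  by rewrite card_prod mulnn.
- rewrite cardsT card_prod -mulnn; suff -> : annihilator sg [set: F * F] = [set (0 : F * F)].
    by rewrite cards1 muln1.
  apply/setP => x; rewrite finset.in_set1; apply/annihilatorP/eqP => [h|-> h _].
    rewrite [x]surjective_pairing; congr pair.
      have := h (0, 1) (finset.in_setT _); rewrite /bil /= mul0r add0r mul1r => /eqP.
      by rewrite mulf_eq0 (negPf sg0) => /eqP.
    by have := h (1, 0) (finset.in_setT _); rewrite /bil /= mul1r mul0r mulr0 addr0.
  by rewrite bil0r.
- rewrite card_line -mulnn leq_mul2l; apply/orP; right.
  have dl : line_dir o \in line o.
    by apply/imsetP; exists 1 => //; rewrite scl1.
  case: o dl => [y|] dl; last first.
    apply: leq_trans (leq_imset_card (fun t => (0, t) : F * F) F).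
    apply: subset_leq_card; apply/fintype.subsetP => x /annihilatorP /(_ _ dl).
    rewrite /bil /= mul0r add0r mul1r => /eqP; rewrite mulf_eq0 (negPf sg0) => /eqP e.
    by apply/imsetP; exists x.2 => //; rewrite [LHS]surjective_pairing e.
  apply: leq_trans (leq_imset_card (fun t => (t, - (sg * (y * t))) : F * F) F).
  apply: subset_leq_card; apply/fintype.subsetP => x /annihilatorP /(_ _ dl).
  rewrite /bil /= mul1r => /eqP; rewrite addr_eq0 => /eqP e.
  by apply/imsetP; exists x.1 => //; rewrite [LHS]surjective_pairing e.
Qed.

End PlaneSubspaces.

(** * Averages of nonconstant phases over a subspace *)

Section Saving.
Variables (R : realType) (F : finFieldType) (alpha : R) (ph psi : F -> R).
Hypotheses (alpha_gt0 : 0 < alpha) (prof : decay_profile alpha ph psi).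
Hypothesis two_neq0 : 2 != 0 :> F.

Lemma sum_psi_affine a e : a != 0 ->
  alpha * #|F|%:R <= \sum_t psi (a * t + e).
Proof.
move=> a0; apply: le_trans (sum_psi prof) _.
by rewrite (reindex_inj (addIr e)) (reindex_inj (mulfI a0)).
Qed.

(** For [g != 0] the difference [f (1 + t) - f t] is affine in [t] with slope [2 * g]. The weak
    triangle inequality bounds its total cost by four times that of [f], hence the loss of a factor
    4. *)
Lemma sum_psi_quad g a e : (g != 0) || (a != 0) ->
  alpha / 4 * #|F|%:R <= \sum_t psi (g * t ^+ 2 + a * t + e).
Proof.
have [->|g0] /= := eqVneq g 0 => a0.
  under eq_bigr do rewrite mul0r add0r.
  apply: le_trans (sum_psi_affine e a0).
  by rewrite ler_wpM2r //; move: alpha_gt0; lra.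
pose f t := g * t ^+ 2 + a * t + e.
have g20 : g * 2 != 0 by rewrite mulf_neq0.
have := sum_psi_affine (g + a) g20.
have : \sum_t psi (g * 2 * t + (g + a)) <= \sum_t 2 * (psi (f (1 + t)) + psi (f t)).
  apply: ler_sum => t _; rewrite -(psiN prof (f t)).
  apply: le_trans (psiD prof _ _); rewrite le_eqVlt; apply/orP; left; apply/eqP.
  by congr psi; rewrite /f; ring.
rewrite -mulr_sumr big_split /= -(reindex_inj (P := xpredT) (F := fun t => psi (f t)) (addrI 1)) /= /f.
by move: (\sum_t psi _) (\sum_t psi _) => S T; lra.
Qed.

(* Averaging over the translates of one line in [H] on which the polynomial is
   nonconstant reduces to one variable. *)
Lemma sum_psi_subspace H lam kap e : subspace H ->
  (forall h h' t, lam (h + scl t h') = lam h + t * lam h') ->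
  (exists2 h, h \in H & lam h + kap * quad h != 0) ->
  alpha / 4 * #|H|%:R <= \sum_(h in H) psi (e + lam h + kap * quad h).
Proof.
move=> HH lamD [h1 h1H k1].
pose be h0 h := lam h0 + kap * (h.1 * h0.2 + h0.1 * h.2).
(* Along [h + scl t h0] the coefficient of [t ^ 2] is [kap * quad h0] and that of [t] is [be h0 h].
   If [kap * quad] vanishes on [H], so does its polar form, and [be h1 h] reduces to [lam h1], which
   is nonzero for the given [h1]. *)
have [h0 h0H nc] : exists2 h0, h0 \in H &
    forall h, h \in H -> (kap * quad h0 != 0) || (be h0 h != 0).
  have [/exists_inP[h0 h0H q0]|/exists_inPn Hz] :=
    boolP [exists h in H, kap * quad h != 0]; first by exists h0 => // h _; rewrite q0.
  have qz h : h \in H -> kap * quad h = 0 by move=> /Hz; rewrite negbK => /eqP.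
  exists h1 => // h hH; apply/orP; right; rewrite /be.
  have -> : kap * (h.1 * h1.2 + h1.1 * h.2) =
      kap * quad (h + h1) - kap * quad h - kap * quad h1 by rewrite /quad /=; ring.
  rewrite !qz ?(subspaceD HH) // !subr0 addr0.
  by rewrite qz // addr0 in k1.
have F0 : 0 < #|F|%:R :> R by rewrite ltr0n; apply/card_gt0P; exists 0.
rewrite -(ler_pM2r F0).
have -> : (\sum_(h in H) psi (e + lam h + kap * quad h)) * #|F|%:R =
    \sum_(t : F) \sum_(h in H) psi (e + lam (h + scl t h0) + kap * quad (h + scl t h0)).
  rewrite mulr_natr -sumr_const; apply: eq_bigr => t _.
  have inj : injective (fun h => h + scl t h0) by apply: addIr.
  rewrite (reindex_inj inj) /=; apply: eq_bigl => h.
  apply/idP/idP => [hH|hH]; last exact: (HH.2).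
  rewrite -[h](addrK (scl t h0)) (subspaceD HH) // (subspaceN HH) //.
  exact: subspaceZ.
rewrite exchange_big /= mulrAC mulr_natr -sumr_const; apply: ler_sum => h hH.
apply: le_trans (sum_psi_quad (e + lam h + kap * quad h) (nc h hH)) _.
apply: ler_sum => t _; rewrite le_eqVlt; apply/orP; left; apply/eqP; congr psi.
by rewrite lamD /be /quad /scl /=; ring.
Qed.

Lemma sum_ph_subspace H lam kap e : subspace H ->
  (forall h h' t, lam (h + scl t h') = lam h + t * lam h') ->
  (exists2 h, h \in H & lam h + kap * quad h != 0) ->
  \sum_(h in H) ph (e + lam h + kap * quad h) <= (1 - alpha / 8) * #|H|%:R.
Proof.
move=> HH lamD nc; have := sum_psi_subspace e HH lamD nc.
have : \sum_(h in H) ph (e + lam h + kap * quad h) <=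
   \sum_(h in H) (1 - psi (e + lam h + kap * quad h) / 2).
  by apply: ler_sum => h _; apply: (ph_le_sub prof).
by rewrite sumrB sumr_const -mulr_suml; lra.
Qed.

End Saving.

(** * Growth of level sets *)

Section Doubling.
Variable F : finFieldType.
Implicit Types (A H : {set F * F}).

Definition sumset A : {set F * F} := [set x + y | x : F * F in A, y : F * F in A].

Lemma mem_sumset A x y : x \in A -> y \in A -> x + y \in sumset A.
Proof. by move=> xA yA; apply/imset2P; exists x y. Qed.

Lemma card_translate A (y : F * F) : #|[set y + t | t : F * F in A]| = #|A|.
Proof. by rewrite card_imset //; apply: addrI. Qed.

(** For [x = y + z] the translates [z + A] and [- y + A] both lie in [sumset A], so they share more
    than half of [#|A|] points; thus more than half of the [t] in [A] satisfy [x + t \in A]. Two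
    such halves meet: a [t] common to [x] and [- y] makes [x + y] the difference of [x + t] and
    [- y + t], both in the symmetric set [A]. *)
Lemma small_doubling A : (forall x, x \in A -> - x \in A) ->
  (2 * #|sumset A| < 3 * #|A|)%N ->
  forall x y, x \in sumset A -> y \in sumset A -> x + y \in sumset A.
Proof.
move=> AN dbl.
pose N (x : F * F) := [set t in A | x + t \in A].
have NA x : N x \subset A by apply/fintype.subsetP => t; rewrite inE => /andP[].
have Nbig x : x \in sumset A -> (#|A| < 2 * #|N x|)%N.
  move=> /imset2P[y z yA zA ->].
  pose S1 : {set F * F} := [set (z : F * F) + t | t : F * F in A].
  pose S2 : {set F * F} := [set - (y : F * F) + t | t : F * F in A].
  have S12 : S1 :|: S2 \subset sumset A.
    apply/fintype.subsetP => u /finset.setUP[] /imsetP[t tA ->]; apply: mem_sumset => //.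
    exact: AN.
  have := subset_leq_card S12; rewrite cardsU !card_translate => le1.
  have : (#|S1 :&: S2| <= #|N (y + z)%R|)%N.
    rewrite -(card_translate _ (- z)); apply: subset_leq_card.
    apply/fintype.subsetP => _ /imsetP[u uS ->].
    case/finset.setIP: uS => /imsetP[t tA ->] /imsetP[t' t'A e].
    rewrite inE addKr tA /= -addrA e addNKr //.
  have : (#|S1 :&: S2| <= #|A|)%N.
    by rewrite -(card_translate A z); apply: subset_leq_card; apply: finset.subsetIl.
  by move: dbl le1; lia.
have sumN x : x \in sumset A -> - x \in sumset A.
  by move=> /imset2P[y z yA zA ->]; rewrite opprD; apply: mem_sumset; apply: AN.
move=> x y /Nbig bx /sumN /Nbig by_.
have : N x :&: N (- y) != finset.set0.
  apply/negP => /eqP e0.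
  have := subset_leq_card (_ : N x :|: N (- y) \subset A).
  rewrite finset.subUset !NA cardsU e0 cards0 => /(_ isT).
  by move: bx by_; lia.
move=> /finset.set0Pn[t /finset.setIP[]]; rewrite !inE => /andP[_ xt] /andP[_ yt].
have -> : x + y = (x + t) + - (- y + t) by rewrite opprD opprK; ring.
by apply: mem_sumset => //; apply: AN.
Qed.

(** A step that grows by a factor less than 3/2 turns [sumset (A k)] into a subgroup, and the later
    sets still contain it. *)
Lemma growth_or_subgroup (A : nat -> {set F * F}) :
  (forall i x, x \in A i -> - x \in A i) -> (forall i, 0 \in A i) ->
  (forall i, sumset (A i) \subset A i.+1) -> forall k,
  (3 ^ k * #|A 0| <= 2 ^ k * #|A k|)%N \/
  exists H, [/\ 0 \in H, forall x y, x \in H -> y \in H -> x + y \in H,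
    A 0 \subset H & H \subset A k].
Proof.
move=> AN A0 AD.
have sub0 i : A i \subset sumset (A i).
  apply/fintype.subsetP => x xA; rewrite -[x]addr0; exact: mem_sumset.
have mono i : A i \subset A i.+1 by apply: fintype.subset_trans (sub0 i) (AD i).
have mono0 i : A 0 \subset A i.
  by elim: i => // i IH; apply: fintype.subset_trans IH (mono i).
elim=> [|k [IH|[H [H0 HD AH HA]]]]; first by left.
  have [big|small] := leqP (3 * #|A k|) (2 * #|A k.+1|).
    by left; rewrite !expnS; move: IH big; nia.
  right; exists (sumset (A k)); split => //.
  - by have := mem_sumset (A0 k) (A0 k); rewrite addr0.
  - apply: small_doubling; first exact: AN.
    by apply: leq_ltn_trans small; rewrite leq_mul2l subset_leq_card.
  - exact: fintype.subset_trans (mono0 k) (sub0 k).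
by right; exists H; split => //; apply: fintype.subset_trans HA (mono k).
Qed.

End Doubling.

Definition annihilator_coset (F : finFieldType) (sg : F) (H : {set F * F})
    (v : F * F) : {set F * F} := [set x : F * F | x - v \in annihilator sg H].

Section LevelSets.
Variables (R : realType) (F : finFieldType) (alpha : R) (ph psi : F -> R).
Hypotheses (alpha_gt0 : 0 < alpha) (prof : decay_profile alpha ph psi).
Hypothesis two_neq0 : 2 != 0 :> F.
Hypothesis F_nat : forall t : F, exists k : nat, t = k%:R.
Variables (sg kap : F).
Hypothesis sg_neq0 : sg != 0.

(** The skew and symmetric models use [kap = 0]. For [sg = 1] and [kap = -1] this is
    [- (w.1 - x.1) * (w.2 - x.2)], the phase of an edge of the Laplacian. *)
Definition pairing (w x : F * F) : F := bil sg w x + kap * quad w + kap * quad x.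

Definition cost m (a : 'I_m -> F * F) (w : F * F) : R :=
  \sum_j psi (pairing w (a j)).

Definition level m (a : 'I_m -> F * F) (s : R) : {set F * F} :=
  [set w | cost a w <= s].

(* The shift [c] absorbs the quadratic part of [pairing], so that the
   differences of elements of [level a s] are seen linearly. *)
Definition linear_level m (a : 'I_m -> F * F) (s : R) : {set F * F} :=
  [set w | [exists c, \sum_j psi (bil sg w (a j) + c) <= s]].

Definition outside m (a : 'I_m -> F * F) (X : {set F * F}) : nat :=
  #|[set j | a j \notin X]|.

Section OneConfiguration.
Variables (m : nat) (a : 'I_m -> F * F).

Lemma linear_levelP w s :
  reflect (exists c, \sum_j psi (bil sg w (a j) + c) <= s) (w \in linear_level a s).
Proof. by rewrite inE; apply: existsP. Qed.

Lemma linear_levelN w s : w \in linear_level a s -> - w \in linear_level a s.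
Proof.
move=> /linear_levelP[c h]; apply/linear_levelP; exists (- c).
apply: le_trans h; rewrite le_eqVlt; apply/orP; left; apply/eqP.
by apply: eq_bigr => j _; rewrite bilNl -opprD (psiN prof).
Qed.

Lemma linear_level0 s : 0 <= s -> 0 \in linear_level a s.
Proof.
move=> s0; apply/linear_levelP; exists 0; rewrite big1 // => j _.
by rewrite bil0l addr0 (psi0 prof).
Qed.

Lemma linear_levelD w w' s : w \in linear_level a s -> w' \in linear_level a s ->
  w + w' \in linear_level a (4 * s).
Proof.
move=> /linear_levelP[c h] /linear_levelP[c' h']; apply/linear_levelP; exists (c + c').
apply: (@le_trans _ _ (2 * (\sum_j psi (bil sg w (a j) + c) +
                           \sum_j psi (bil sg w' (a j) + c')))).
  rewrite -big_split mulr_sumr /=; apply: ler_sum => j _.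
  by rewrite bilDl addrACA; apply: (psiD prof).
by lra.
Qed.

Lemma level_sub w w' s : w \in level a s -> w' \in level a s ->
  w - w' \in linear_level a (4 * s).
Proof.
rewrite !inE => h h'; apply/existsP; exists (kap * quad w - kap * quad w').
apply: (@le_trans _ _ (2 * (cost a w + cost a w'))); last by lra.
rewrite -big_split mulr_sumr /=; apply: ler_sum => j _.
rewrite -[X in _ <= 2 * (_ + X)](psiN prof).
apply: le_trans (psiD prof _ _).
rewrite le_eqVlt; apply/orP; left; apply/eqP; congr psi.
by rewrite /pairing bilDl bilNl; ring.
Qed.

Lemma expR_neg_le (y : R) : 0 <= y -> y <= 1 -> expR (- y) <= 1 - y / 2.
Proof.
move=> y0 y1; rewrite expRN; have := expR_ge1Dx y => h.
have e0 : 0 < expR y by apply: expR_gt0.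
rewrite invf_ple ?posrE //; last by lra.
apply: le_trans h; rewrite -[leLHS]mul1r ler_pdivrMr; last by lra.
by nra.
Qed.

Definition sample_set r (tc : 'I_r -> (F * F) * F) : {set F * F} :=
  [set x | \sum_i psi (bil sg (tc i).1 x + (tc i).2) <= alpha / 8 * r%:R].

(* Chernoff: a sample of logarithmic size from [T] detects every point of large
   average cost over [T]. *)
Lemma exists_sample (T : {set F * F}) (c : F * F -> F) r :
  (0 < #|T|)%N -> #|F|%:R ^+ 2 < expR (alpha / 8 * r%:R) ->
  exists2 t : 'I_r -> F * F, (forall i, t i \in T) &
    forall x, x \in sample_set (fun i => (t i, c (t i))) ->
      \sum_(w in T) psi (bil sg w x + c w) <= alpha / 2 * #|T|%:R.
Proof.
move=> T0 hr; set de := alpha / 8 in hr.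
pose good x := \sum_(w in T) psi (bil sg w x + c w) <= alpha / 2 * #|T|%:R.
(* Exponential moments: [ex t x] is at least one when [x] lies in the sample set of [t]. For a bad
   [x] the mean of [psi] exceeds [4 * de]; replacing [expR (- psi)] by [1 - psi / 2] leaves
   [2 * de], so each factor averages at most [expR (- de)]. The union over [x] costs [#|F| ^ 2]. *)
pose ex (t : {ffun 'I_r -> F * F}) x : R :=
  \prod_i expR (de - psi (bil sg (t i) x + c (t i))).
have ex_ge1 (t : {ffun _}) x : x \in sample_set (fun i => (t i, c (t i))) -> 1 <= ex t x.
  rewrite inE /= => h; rewrite /ex -expR_sum -expR0 ler_expR sumrB sumr_const card_ord.
  by rewrite -mulr_natr subr_ge0.
have bad_le x : ~~ good x ->
    \sum_(t in ffun_on (mem T)) ex t x <= (expR (- de) * #|T|%:R) ^+ r.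
  move=> bx; rewrite /ex.
  rewrite -(bigA_distr_big (mem T) (fun i w => expR (de - psi (bil sg w x + c w)))).
  rewrite prodr_const card_ord lerXn2r ?nnegrE ?mulr_ge0 ?expR_ge0 //.
    by apply: sumr_ge0 => w _; apply: expR_ge0.
  under eq_bigr do rewrite expRD; rewrite -mulr_sumr.
  have -> : - de = de + - (2 * de) by lra.
  rewrite expRD -mulrA ler_wpM2l ?expR_ge0 //.
  apply: (@le_trans _ _ ((1 - 2 * de) * #|T|%:R)); last first.
    by rewrite ler_wpM2r // expR_ge1Dx.
  apply: (@le_trans _ _ (\sum_(w in T) (1 - psi (bil sg w x + c w) / 2))).
    by apply: ler_sum => w _; apply: expR_neg_le; [apply: (psi_ge0 prof)|apply: (psi_le1 prof)].
  rewrite sumrB sumr_const -mulr_suml; move: bx; rewrite /good -ltNge.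
  by rewrite /de; lra.
have [/existsP[t /andP[tT /forall_inP gt]]|no] :=
  boolP [exists t : {ffun 'I_r -> F * F}, (t \in ffun_on (mem T)) &&
    [forall x in sample_set (fun i => (t i, c (t i))), good x]].
  exists t => [i|x xS]; first by have /ffun_onP := tT; apply.
  exact: gt.
exfalso; move: hr; apply/negP; rewrite -leNgt.
have le1 : \sum_(t in ffun_on (mem T) : {pred {ffun 'I_r -> F * F}}) 1 <=
    \sum_(x | ~~ good x) \sum_(t in ffun_on (mem T)) ex t x.
  rewrite exchange_big /=; apply: ler_sum => t tT.
  have /exists_inP[x xS bx] :
      [exists x in sample_set (fun i => (t i, c (t i))), ~~ good x].
    by move: no; rewrite negb_exists => /forallP/(_ t); rewrite tT /= negb_forall_in.
  rewrite (bigD1 x) //= -[leLHS]addr0 lerD ?ex_ge1 //.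
  by apply: sumr_ge0 => y _; apply: prodr_ge0 => i _; apply: expR_ge0.
have := le_trans le1 (ler_sum _ bad_le).
rewrite !sumr_const card_ffun_on card_ord -mulr_natr mul1r natrX exprMn.
rewrite -[X in _ <= X *+ _]mulrC -mulrnAr.
have Tr : 0 < #|T|%:R ^+ r :> R by rewrite exprn_gt0 // ltr0n.
rewrite -[leLHS]mulr1 ler_pM2l // -expRM_natr -mulr_natr.
rewrite mulNr expRN -[leLHS]/1 mulrC ler_pdivlMr ?expR_gt0 // mul1r => h.
apply: le_trans h _; rewrite -natrX ler_nat -mulnn -card_prod.
exact: max_card.
Qed.

(** Double counting of the cost over sample points and indices: each exceptional index pays at least
    [alpha / 8 * r]. *)
Lemma outside_sample r (tc : 'I_r -> (F * F) * F) s : (0 < r)%N ->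
  (forall i, \sum_j psi (bil sg (tc i).1 (a j) + (tc i).2) <= s) ->
  (outside a (sample_set tc))%:R * (alpha / 8) <= s.
Proof.
move=> r0 h; have r0' : 0 < r%:R :> R by rewrite ltr0n.
rewrite -(ler_pM2r r0') -mulrA.
apply: (@le_trans _ _ (\sum_j \sum_(i < r) psi (bil sg (tc i).1 (a j) + (tc i).2))).
  rewrite mulr_natl -sumr_const.
  rewrite [leRHS](bigID (fun j => a j \notin sample_set tc)) /= -[leLHS]addr0 lerD //.
    under eq_bigl do rewrite inE.
    by apply: ler_sum => j; rewrite inE -ltNge => /ltW.
  by apply: sumr_ge0 => j _; apply: sumr_ge0 => i _; apply: (psi_ge0 prof).
rewrite exchange_big /= mulr_natr.
apply: le_trans (ler_sum _ (fun i _ => h i)) _.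
by rewrite sumr_const card_ord.
Qed.

(** The shift [v] is one of the points [a j']. Passing to differences [a j - a j'] removes the
    unknown constants of [linear_level]. A difference outside the annihilator gives a nonconstant
    phase on [H], of mean cost at least [alpha / 4], and averaging over [j'] finds a suitable
    one. *)
Lemma outside_annihilator H s : (0 < m)%N -> subspace H ->
  H \subset linear_level a s ->
  exists v, (outside a (annihilator_coset sg H v))%:R * (alpha / 16) <= s.
Proof.
move=> m0 HH /fintype.subsetP HA.
have H0 : 0 < #|H|%:R :> R by rewrite ltr0n; apply/card_gt0P; exists 0; exact: HH.1.
pose N v := (outside a (annihilator_coset sg H v))%:R * (alpha / 16).
have N_le v : N v * #|H|%:R * 4 <= \sum_j \sum_(h in H) psi (bil sg h (a j - v)).
  rewrite [leRHS](bigID (fun j => a j - v \notin annihilator sg H)) /= -[leLHS]addr0 lerD //; last first.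
    by apply: sumr_ge0 => j _; apply: sumr_ge0 => i _; apply: (psi_ge0 prof).
  have -> : N v * #|H|%:R * 4 =
      \sum_(j | a j - v \notin annihilator sg H) alpha / 4 * #|H|%:R.
    rewrite sumr_const -mulr_natl /N /outside (eq_card (B := [set j | a j - v \notin annihilator sg H])).
      by rewrite cardsE; field.
    by move=> j; rewrite !inE.
  apply: ler_sum => j nj.
  have [h hH hn] : exists2 h, h \in H & bil sg h (a j - v) + 0 * quad h != 0.
    move: nj; rewrite inE negb_forall_in => /exists_inP[h hH hn].
    by exists h => //; rewrite mul0r addr0.
  have lin h1 h2 t : bil sg (h1 + scl t h2) (a j - v) = bil sg h1 (a j - v) + t * bil sg h2 (a j - v).
    by rewrite bilDl bil_scll.
  have := sum_psi_subspace alpha_gt0 prof two_neq0 0 HH lin (ex_intro2 _ _ h hH hn).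
  by congr (_ <= _); apply: eq_bigr => h' _; rewrite mul0r addr0 add0r.
have tot : \sum_(j' < m) \sum_j \sum_(h in H) psi (bil sg h (a j - a j')) <=
    (m%:R * (4 * s * #|H|%:R)).
  rewrite exchange_big /=; under eq_bigr do rewrite exchange_big /=.
  rewrite exchange_big /=.
  have -> : m%:R * (4 * s * #|H|%:R) = \sum_(h in H) (m%:R * (4 * s)).
    by rewrite sumr_const -mulr_natr; ring.
  apply: ler_sum => h /HA /linear_levelP[c hc].
  apply: (@le_trans _ _ (\sum_(j < m) \sum_(j' < m)
     2 * (psi (bil sg h (a j) + c) + psi (bil sg h (a j') + c)))).
    apply: ler_sum => j _; apply: ler_sum => j' _.
    rewrite -[X in _ <= 2 * (_ + X)](psiN prof); apply: le_trans (psiD prof _ _).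
    rewrite le_eqVlt; apply/orP; left; apply/eqP; congr psi.
    by rewrite bilDr bilNr; ring.
  under eq_bigr do rewrite -mulr_sumr big_split /= sumr_const card_ord.
  rewrite -mulr_sumr big_split /= sumr_const card_ord sumrMnl -(mulr_natl _ m).
  have m0' : 0 < m%:R :> R by rewrite ltr0n.
  have : m%:R * (\sum_(i < m) psi (bil sg h (a i) + c)) <= m%:R * s by rewrite ler_pM2l.
  by lra.
have [/existsP[j' hj]|/existsPn hn] := boolP [exists j' : 'I_m, N (a j') <= s].
  by exists (a j').
exfalso; move: tot; apply/negP; rewrite -ltNge.
have -> : m%:R * (4 * s * #|H|%:R) = \sum_(j' < m) (4 * s * #|H|%:R).
  by rewrite sumr_const card_ord mulr_natl.
apply: ltr_sum; first by rewrite /index_enum -enumT has_predT size_enum_ord.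
move=> j' _; apply: lt_le_trans (N_le (a j')).
have : s < N (a j').
  by rewrite ltNge; apply: hn.
by rewrite -(ltr_pM2r H0); move: (N _) => n; lra.
Qed.

(** Growth is applied to the linear level sets at costs [4 ^ i.+1 * s]; the first contains a
    translate of [level a s]. If the last one is [(3 / 2) ^ k] times larger, uncertainty makes the
    sample set smaller by the same factor. The bound on the sample set alone serves to absorb the
    tail outside the level set. *)
Lemma level_dichotomy s k r : 0 <= s -> (0 < r)%N ->
  #|F|%:R ^+ 2 < expR (alpha / 8 * r%:R) ->
  (exists tc : {ffun 'I_r -> (F * F) * F},
     [/\ (outside a (sample_set tc))%:R * (alpha / 8) <= 4 ^+ k.+1 * s,
      (alpha / 2) ^+ 2 * (3 / 2) ^+ k * (#|sample_set tc| * #|level a s|)%:R <= #|F|%:R ^+ 2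
    & (alpha / 2) ^+ 2 * (3 / 2) ^+ k * #|sample_set tc|%:R <= #|F|%:R ^+ 2]) \/
  (exists H, [/\ subspace H, exists w0, forall w, w \in level a s -> w - w0 \in H
    & H \subset linear_level a (4 ^+ k.+1 * s)]).
Proof.
move=> s0 r0 hr; pose A i := linear_level a (4 ^+ i.+1 * s).
have As i : 0 <= 4 ^+ i.+1 * s by rewrite mulr_ge0 // exprn_ge0.
have TA : (#|level a s| <= #|A 0|)%N.
  have [->|[w0 hw0]] := set_0Vmem (level a s); first by rewrite cards0.
  rewrite -(card_translate _ (- w0)); apply: subset_leq_card.
  apply/fintype.subsetP => _ /imsetP[w hw ->]; rewrite addrC /A expr1.
  exact: level_sub.
have A0 i : 0 \in A i by apply: linear_level0.
have [] := @growth_or_subgroup F A _ A0 _ k.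
- by move=> i x; apply: linear_levelN.
- move=> i; apply/fintype.subsetP => _ /imset2P[x y xA yA ->].
  by rewrite /A exprS -mulrA; apply: linear_levelD.
- move=> big; left.
  pose c w : F := if [pick c | \sum_j psi (bil sg w (a j) + c) <= 4 ^+ k.+1 * s] is Some c
                  then c else 0.
  have cP w : w \in A k -> \sum_j psi (bil sg w (a j) + c w) <= 4 ^+ k.+1 * s.
    move=> /linear_levelP[c0 h0]; rewrite /c; case: pickP => // /(_ c0).
    by rewrite h0.
  have Ak0 : (0 < #|A k|)%N by apply/card_gt0P; exists 0.
  have [t tA tS] := exists_sample c Ak0 hr.
  exists [ffun i => (t i, c (t i))].
  have eS : sample_set [ffun i => (t i, c (t i))] = sample_set (fun i => (t i, c (t i))).
    by apply/setP => x; rewrite !inE; congr (_ <= _); apply: eq_bigr => i _; rewrite ffunE.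
  rewrite eS; have unc := psi_uncertainty prof sg_neq0 tS.
  have big' : (3 / 2) ^+ k * #|A 0|%:R <= #|A k|%:R :> R.
    rewrite expr_div_n mulrAC ler_pdivrMr ?exprn_gt0 // -!natrX -!natrM ler_nat.
    by rewrite [leqRHS]mulnC.
  have fin (n : nat) : (n <= #|A 0|)%N ->
      (alpha / 2) ^+ 2 * (3 / 2) ^+ k *
      (#|sample_set (fun i => (t i, c (t i)))| * n)%:R <= #|F|%:R ^+ 2.
    move=> hn; apply: le_trans unc; rewrite -mulrA ler_wpM2l ?sqr_ge0 //.
    rewrite !natrM mulrCA ler_wpM2l //; apply: le_trans big'.
    by rewrite ler_wpM2l ?exprn_ge0 // ?ler_nat // divr_ge0.
  split; [|exact: fin|].
  + apply: (outside_sample r0) => i; exact: (cP _ (tA i)).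
  + rewrite -[#|_|%N]muln1; apply: fin.
    by apply/card_gt0P; exists 0.
- move=> [H [H0 HD AH HA]]; right; exists H; split => //.
    exact: subspace_closed_addr.
  have [->|[w0 hw0]] := set_0Vmem (level a s); first by exists 0 => w; rewrite inE.
  exists w0 => w hw; apply: (fintype.subsetP AH); rewrite /A expr1.
  exact: level_sub.
Qed.

End OneConfiguration.
End LevelSets.

(** * Classification of configurations *)

Lemma sum_le_cover (R : realDomainType) (I T : finType) (P : I -> pred T)
    (Q : pred T) (f : T -> R) : (forall a, 0 <= f a) ->
  (forall a, Q a -> exists i, P i a) ->
  \sum_(a | Q a) f a <= \sum_i \sum_(a | P i a) f a.
Proof.
move=> f0 QP; under [leRHS]eq_bigr do rewrite big_mkcond /=.
rewrite exchange_big /= [leLHS]big_mkcond /=; apply: ler_sum => a _.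
case: ifP => [/QP[i Pi]|_]; last by apply: sumr_ge0 => i _; case: ifP.
rewrite (bigD1 i) //= Pi lerDl; apply: sumr_ge0 => j _; by case: ifP.
Qed.

Lemma sum_le_or (R : realDomainType) (T : finType) (Q Q1 Q2 : pred T) (f : T -> R) :
  (forall a, 0 <= f a) -> (forall a, Q a -> Q1 a || Q2 a) ->
  \sum_(a | Q a) f a <= \sum_(a | Q1 a) f a + \sum_(a | Q2 a) f a.
Proof.
move=> f0 QP; rewrite [leLHS]big_mkcond [X in _ <= X + _]big_mkcond.
rewrite [X in _ <= _ + X]big_mkcond -big_split /=; apply: ler_sum => a _.
have := QP a; have := f0 a.
by case: (Q a) (Q1 a) (Q2 a) => [] [] [] //= a0; rewrite ?addr0 ?add0r ?lerDl ?addr_ge0 // => /(_ isT).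
Qed.

Lemma sum_pred_le (R : realDomainType) (T : finType) (P : pred T) (f : T -> R) b N :
  0 <= b -> (#|P| <= N)%N -> (forall a, P a -> f a <= b) ->
  \sum_(a | P a) f a <= N%:R * b.
Proof.
move=> b0 PN fb; apply: le_trans (ler_sum _ fb) _.
by rewrite sumr_const -(mulr_natl b) ler_wpM2r // ler_nat.
Qed.

(** A configuration is decoded from [e] optional indices, [e] replacement values and a configuration
    inside [X]. A slot has [m.+1] choices because [None] marks it as empty. *)
Lemma card_few_outside (F : finFieldType) m e (X : {set F * F}) : (0 < #|X|)%N ->
  (#|[pred a : {ffun 'I_m -> F * F} | (outside a X <= e)%N]| <=
     m.+1 ^ e * (#|F| ^ 2) ^ e * #|X| ^ m)%N.
Proof.
move=> /card_gt0P[x0 x0X].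
pose dec (p : ({ffun 'I_e -> option 'I_m} * {ffun 'I_e -> F * F}) *
    {ffun 'I_m -> F * F}) : {ffun 'I_m -> F * F} :=
  [ffun j => if [pick i | p.1.1 i == Some j] is Some i then p.1.2 i else p.2 j].
pose D := finset.setX [set: {ffun 'I_e -> option 'I_m} * {ffun 'I_e -> F * F}]
  [set f : {ffun 'I_m -> F * F} | f \in ffun_on (mem X)].
have <- : #|D| = (m.+1 ^ e * (#|F| ^ 2) ^ e * #|X| ^ m)%N.
  rewrite /D cardsX cardsT cardsE card_ffun_on card_prod !card_ffun !card_ord.
  by rewrite card_option card_ord card_prod mulnn.
apply: leq_trans (leq_imset_card dec D); apply: subset_leq_card.
apply/fintype.subsetP => a; rewrite !inE => ae.
pose out := enum [set j | a j \notin X].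
have so : (size out <= e)%N by rewrite -cardE.
pose f := [ffun i : 'I_e => nth None (map Some out) i] : {ffun 'I_e -> option 'I_m}.
pose v := [ffun i : 'I_e => if f i is Some j then a j else x0] : {ffun 'I_e -> F * F}.
pose a' := [ffun j => if a j \in X then a j else x0] : {ffun 'I_m -> F * F}.
apply/imsetP; exists (f, v, a').
  rewrite finset.in_setX finset.in_setT inE; apply/ffun_onP => j; rewrite ffunE.
  by case: ifP.
apply/ffunP => j; rewrite ffunE /=; case: pickP => [i /eqP fi|no].
  by rewrite ffunE fi.
rewrite ffunE; case: ifPn => // jX.
have jo : j \in out by rewrite mem_enum inE.
have ji : (index j out < e)%N by apply: leq_trans so; rewrite index_mem.
have := no (Ordinal ji); rewrite ffunE /= (nth_map j) ?index_mem // nth_index //.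
by rewrite eqxx.
Qed.

Definition plane_subspace (F : finFieldType) (i : bool + option F) : {set F * F} :=
  match i with
  | inl true => [set (0 : F * F)]
  | inl false => [set: F * F]
  | inr o => line o
  end.

Lemma subspace_line (F : finFieldType) (o : option F) : subspace (line o).
Proof.
split; first by apply/imsetP; exists 0; rewrite // /scl !mul0r.
move=> _ _ t /imsetP[t1 _ ->] /imsetP[t2 _ ->]; apply/imsetP.
by exists (t1 + t * t2); rewrite // /scl /=; congr pair; rewrite /=; ring.
Qed.

Lemma plane_subspaceP (F : finFieldType) i : subspace (@plane_subspace F i).
Proof.
case: i => [[]|o] /=; last exact: subspace_line.
  split; first by rewrite inE.
  by move=> h h' t; rewrite !inE => /eqP -> /eqP ->; rewrite /scl /= !mulr0 add0r.
by split => *; rewrite inE.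
Qed.

Lemma subspace_plane_subspace (F : finFieldType) (H : {set F * F}) :
  subspace H -> exists i, H = plane_subspace i.
Proof.
move=> /subspace_cases[->|[->|[ o ->]]].
- by exists (inl true).
- by exists (inl false).
- by exists (inr o).
Qed.

Section Configurations.
Variables (R : realType) (F : finFieldType) (alpha : R) (ph psi : F -> R).
Hypotheses (alpha_gt0 : 0 < alpha) (alpha_le1 : alpha <= 1).
Hypothesis prof : decay_profile alpha ph psi.
Hypothesis two_neq0 : 2 != 0 :> F.
Hypothesis F_nat : forall t : F, exists k : nat, t = k%:R.
Variables (sg kap gam : F).
Hypothesis sg_neq0 : sg != 0.

Local Notation q := (#|F|).
Local Notation pairing := (pairing sg kap).
Local Notation level := (level psi sg kap).

(** The factor attached to a single point: a diagonal entry in the symmetric model ([gam = 1]), the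
    edge to the removed vertex in the Laplacian ([gam = -1]), and [1] in the skew model
    ([gam = 0]). *)
Definition site w := ph (gam * quad w).

Definition fiber_sum m (a : 'I_m -> F * F) : R :=
  \sum_w site w * \prod_j ph (pairing w (a j)).

Lemma ph_le1 t : ph t <= 1.
Proof. by have := ph_le_sub prof t; have := psi_ge0 prof t; lra. Qed.

Lemma fiber_term_ge0 m (a : 'I_m -> F * F) w :
  0 <= site w * \prod_j ph (pairing w (a j)).
Proof. by rewrite mulr_ge0 ?(ph_ge0 prof) // prodr_ge0 // => j _; apply: (ph_ge0 prof). Qed.

Lemma fiber_sum_ge0 m (a : 'I_m -> F * F) : 0 <= fiber_sum a.
Proof. by apply: sumr_ge0 => w _; apply: fiber_term_ge0. Qed.

Lemma prod_ph_le1 (I : finType) (P : pred I) (f : I -> F) : \prod_(i | P i) ph (f i) <= 1.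
Proof. by apply: prodr_ile1 => i _; rewrite (ph_ge0 prof) ph_le1. Qed.

Lemma fiber_term_le_pairing m (a : 'I_m -> F * F) w j :
  site w * \prod_j ph (pairing w (a j)) <= ph (pairing w (a j)).
Proof.
apply: (@le_trans _ _ (\prod_j ph (pairing w (a j)))).
  rewrite ler_piMl ?ph_le1 // prodr_ge0 // => i _; exact: (ph_ge0 prof).
by rewrite (bigD1 j) //= ler_piMr ?prod_ph_le1 // (ph_ge0 prof).
Qed.

Lemma fiber_term_le_site m (a : 'I_m -> F * F) w :
  site w * \prod_j ph (pairing w (a j)) <= site w.
Proof. by rewrite ler_piMr ?prod_ph_le1 // (ph_ge0 prof). Qed.

Lemma fiber_term_le1 m (a : 'I_m -> F * F) w :
  site w * \prod_j ph (pairing w (a j)) <= 1.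
Proof. exact: le_trans (fiber_term_le_site _ _) (ph_le1 _). Qed.

Lemma fiber_sum_level m (a : 'I_m -> F * F) s :
  q%:R ^+ 2 * expR (- (s / 2)) <= q%:R^-1 ->
  fiber_sum a <= \sum_(w in level a s) site w * \prod_j ph (pairing w (a j)) + q%:R^-1.
Proof.
move=> hs; rewrite /fiber_sum (bigID (mem (level a s))) /= lerD2l.
apply: le_trans hs; rewrite -natrX -mulnn -card_prod.
apply: (@le_trans _ _ (\sum_(w | w \notin level a s) expR (- (s / 2)))).
  apply: ler_sum => w; rewrite inE -ltNge => hw.
  apply: (@le_trans _ _ (\prod_j ph (pairing w (a j)))).
    rewrite ler_piMl ?ph_le1 // prodr_ge0 // => i _; exact: (ph_ge0 prof).
  apply: (@le_trans _ _ (\prod_j expR (- (psi (pairing w (a j)) / 2)))).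
    by apply: ler_prod => j _; rewrite (ph_ge0 prof) (ph_le_exp prof).
  rewrite -expR_sum ler_expR sumrN lerN2 -mulr_suml ler_wpM2r ?invr_ge0 //.
  exact: ltW.
rewrite sumr_const -(mulr_natl (expR _)) ler_wpM2r ?expR_ge0 // ler_nat.
exact: max_card.
Qed.

Section Bounds.
Variables (m : nat) (s : R) (k r e : nat).
Hypotheses (s_ge0 : 0 <= s) (r_gt0 : (0 < r)%N) (e_lt_m : (e < m)%N).
Hypothesis tail_le : q%:R ^+ 2 * expR (- (s / 2)) <= q%:R^-1.
Hypothesis sample_large : q%:R ^+ 2 < expR (alpha / 8 * r%:R).
Hypothesis growth_large : 8 <= (alpha / 2) ^+ 2 * (3 / 2) ^+ k.
Hypothesis exceptions_le : 4 ^+ k.+1 * s <= e%:R * (alpha / 16).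
Hypothesis q_large : q%:R^-1 <= alpha / 16.

(** Here [tc], and in [losing] the pair of a subspace and a shift, are labels from a fixed finite
    set. In both classes the fiber sum times the size of the confining set is at most [q ^ 2] times
    a constant below one. *)
Definition growing (a : {ffun 'I_m -> F * F}) (tc : {ffun 'I_r -> (F * F) * F}) : bool :=
  (outside a (sample_set alpha psi sg tc) <= e)%N &&
  (fiber_sum a * #|sample_set alpha psi sg tc|%:R <= q%:R ^+ 2 / 4).

Definition losing (a : {ffun 'I_m -> F * F}) (p : (bool + option F) * (F * F)) : bool :=
  (outside a (annihilator_coset sg (plane_subspace p.1) p.2) <= e)%N &&
  (fiber_sum a <= #|plane_subspace p.1|%:R * (1 - alpha / 16)).

Let q_gt0 : 0 < q%:R :> R.
Proof. by rewrite ltr0n; apply/card_gt0P; exists 0. Qed.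

Lemma level_growing a :
  (exists tc, growing a tc) \/
  (exists H, [/\ subspace H, exists w0, forall w, w \in level a s -> w - w0 \in H
    & exists v, (outside a (annihilator_coset sg H v) <= e)%N]).
Proof.
have a16 : 0 < alpha / 16 by rewrite divr_gt0.
have a8 : 0 < alpha / 8 by rewrite divr_gt0.
have [[tc [h1 h2 h3]]|[H [HH Hw HA]]] :=
  level_dichotomy prof F_nat kap sg_neq0 a k s_ge0 r_gt0 sample_large.
  left; exists tc; apply/andP; split.
    rewrite -(ler_nat R) -(ler_pM2r a8); apply: le_trans h1 _.
    apply: le_trans exceptions_le _; rewrite ler_wpM2l //.
    by move: alpha_gt0; lra.
  (* Origin of the [8] in [growth_large]: the sample size times [#|level a s|] and the sample size
     alone are each at most [q ^ 2 / 8]; the second covers the tail, which is at most [1]. *)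
  have g (n : nat) : (alpha / 2) ^+ 2 * (3 / 2) ^+ k * n%:R <= q%:R ^+ 2 -> 8 * n%:R <= q%:R ^+ 2 :> R.
    by move=> h; apply: le_trans h; rewrite ler_wpM2r.
  move: h2 h3 => /g h2 /g h3.
  have fs : fiber_sum a <= #|level a s|%:R + 1.
    apply: le_trans (fiber_sum_level a tail_le) _; apply: lerD.
      rewrite -sumr_const; apply: ler_sum => w _; exact: fiber_term_le1.
    by apply: le_trans q_large _; move: alpha_le1; lra.
  apply: (@le_trans _ _ ((#|level a s|%:R + 1) * #|sample_set alpha psi sg tc|%:R)).
    by rewrite ler_wpM2r.
  by rewrite natrM in h2; lra.
right; exists H; split => //.
have m_gt0 : (0 < m)%N by apply: leq_ltn_trans e_lt_m.
have [v hv] := outside_annihilator alpha_gt0 prof two_neq0 m_gt0 HH HA.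
exists v; rewrite -(ler_nat R) -(ler_pM2r a16); exact: le_trans hv exceptions_le.
Qed.

Lemma sum_over_level (a : {ffun 'I_m -> F * F}) (H : {set F * F}) w0 (f : F * F -> R) :
  (forall w, w \in level a s -> w - w0 \in H) -> (forall w, 0 <= f w) ->
  (forall w, site w * \prod_j ph (pairing w (a j)) <= f w) ->
  fiber_sum a <= \sum_(h in H) f (w0 + h) + q%:R^-1.
Proof.
move=> HT f0 fle; apply: le_trans (fiber_sum_level a tail_le) _; rewrite lerD2r.
apply: le_trans (ler_sum _ (fun w _ => fle w)) _.
rewrite [leRHS](reindex_inj (addIr (- w0))) /=.
under [leRHS]eq_bigr do rewrite addrC subrK.
rewrite [leLHS]big_mkcond [leRHS]big_mkcond /=; apply: ler_sum => w _.
case: ifP => [/HT ->//|_]; by case: ifP.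
Qed.

(* The last alternative says that all the phases are constant on the coset
   [w0 + H] carrying the level set; a nonconstant one costs a constant factor. *)
Lemma fiber_sum_cases a :
  [\/ exists tc, growing a tc, exists p, losing a p |
   exists H w0, [/\ subspace H, forall w, w \in level a s -> w - w0 \in H,
    forall j h, h \in H ->
      bil sg h (a j) + kap * (w0.1 * h.2 + w0.2 * h.1) + kap * quad h = 0
    & forall h, h \in H -> gam * (w0.1 * h.2 + w0.2 * h.1) + gam * quad h = 0]].
Proof.
have [hg|[H [HH [w0 Hw0] [v hv]]]] := level_growing a; first by constructor 1.
(* As [#|H|] is at least one, half of the saving [alpha / 8] absorbs the tail [q^-1]. *)
have lose : fiber_sum a <= (1 - alpha / 8) * #|H|%:R + q%:R^-1 -> exists p, losing a p.
  move=> h; have [i Hi] := subspace_plane_subspace HH.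
  exists (i, v); rewrite /losing /= -Hi hv /=; apply: le_trans h _.
  have H1 : 1 <= #|H|%:R :> R.
    by rewrite ler1n; apply/card_gt0P; exists 0; exact: HH.1.
  by move: q_large alpha_gt0; nra.
have [/existsP[j /exists_inP[h hH nc]]|/existsPn hc] := boolP [exists j, [exists h in H,
    bil sg h (a j) + kap * (w0.1 * h.2 + w0.2 * h.1) + kap * quad h != 0]].
  constructor 2; apply: lose.
  apply: le_trans (sum_over_level Hw0 (fun w => ph_ge0 prof (pairing w (a j))) _) _.
    by move=> w; apply: fiber_term_le_pairing.
  rewrite lerD2r.
  pose lam (h : F * F) := bil sg h (a j) + kap * (w0.1 * h.2 + w0.2 * h.1).
  have lamD h1 h2 t : lam (h1 + scl t h2) = lam h1 + t * lam h2.
    by rewrite /lam bilDl bil_scll /scl /=; ring.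
  have := sum_ph_subspace alpha_gt0 prof two_neq0 (pairing w0 (a j)) HH lamD
    (ex_intro2 _ _ h hH nc).
  congr (_ <= _); apply: eq_bigr => h' _; congr ph.
  by rewrite /pairing /lam bilDl /quad /=; ring.
have [/exists_inP[h hH nc]|/exists_inPn hg] := boolP [exists h in H,
    gam * (w0.1 * h.2 + w0.2 * h.1) + gam * quad h != 0].
  constructor 2; apply: lose.
  apply: le_trans (sum_over_level Hw0 (fun w => ph_ge0 prof (gam * quad w)) _) _.
    by move=> w; apply: fiber_term_le_site.
  rewrite lerD2r.
  pose lam (h : F * F) := gam * (w0.1 * h.2 + w0.2 * h.1).
  have lamD h1 h2 t : lam (h1 + scl t h2) = lam h1 + t * lam h2.
    by rewrite /lam /scl /=; ring.
  have := sum_ph_subspace alpha_gt0 prof two_neq0 (gam * quad w0) HH lamD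
    (ex_intro2 _ _ h hH nc).
  congr (_ <= _); apply: eq_bigr => h' _; congr ph.
  by rewrite /lam /quad /=; ring.
constructor 3; exists H, w0; split => // [j h hH|h hH].
  move: (hc j); rewrite negb_exists => /forallP/(_ h).
  by rewrite hH /= negbK => /eqP.
by move: (hg h hH); rewrite negbK => /eqP.
Qed.

Lemma fiber_sum_subset (a : {ffun 'I_m -> F * F}) (H : {set F * F}) w0 :
  (forall w, w \in level a s -> w - w0 \in H) ->
  fiber_sum a <= #|H|%:R + q%:R^-1.
Proof.
move=> Hw0; have := sum_over_level Hw0 (f := fun=> 1) (fun=> ler01) (fiber_term_le1 a).
by rewrite sumr_const.
Qed.

(** The site identity at [h] and at [- h] gives [2 * gam * quad h = 0]. So [quad] vanishes on [H],
    and a nonzero [H] is a coordinate axis; constancy of the pairings then puts every [a j] on the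
    same axis. These are the configurations whose first half has [u = 0] or [v = 0]. *)
Lemma fiber_sum_cases_site (sg1 : sg = 1) (gam0 : gam != 0) (a : {ffun 'I_m -> F * F}) :
  [\/ exists tc, growing a tc, exists p, losing a p |
   fiber_sum a <= 1 + q%:R^-1 \/
   exists b : bool, (forall j, a j \in line (if b then None else Some 0)) /\
     fiber_sum a <= q%:R + q%:R^-1].
Proof.
have [h1|h2|[H [w0 [HH Hw0 hc hg]]]] := fiber_sum_cases a;
  [by constructor 1|by constructor 2|constructor 3].
have key h : h \in H -> quad h = 0 /\ w0.1 * h.2 + w0.2 * h.1 = 0.
  move=> hH; have := hg _ hH; have := hg _ (subspaceN HH hH).
  rewrite /quad /= -!mulrDr => /eqP; rewrite mulf_eq0 (negPf gam0) /= => /eqP e1.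
  move=> /eqP; rewrite mulf_eq0 (negPf gam0) /= => /eqP e2.
  have q0 : h.1 * h.2 = 0.
    apply/eqP; rewrite -(mulrI_eq0 _ (lregP two_neq0)).
    by apply/eqP; rewrite -[RHS]addr0 -{1}e1 -e2; ring.
  by split => //; rewrite q0 addr0 in e2.
have [/exists_inP[h0 h0H hn]|/exists_inPn Hz] := boolP [exists h in H, h != 0]; last first.
  left; have HE : H = [set (0 : F * F)].
    apply/setP => x; rewrite inE; apply/idP/eqP => [/Hz|->]; last exact: HH.1.
    by rewrite negbK => /eqP.
  by have := fiber_sum_subset Hw0; rewrite HE cards1.
right; have [q0 p0] := key _ h0H.
have quadD h : h \in H -> h0.1 * h.2 + h0.2 * h.1 = 0.
  move=> hH; have [qh _] := key _ hH; have [] := key _ (subspaceD HH h0H hH).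
  rewrite /quad /= => qD _; rewrite /quad in q0 qh.
  by rewrite -[RHS]subr0 -{2}q0 -[RHS]subr0 -{2}qh -qD; ring.
have ba j : h0.1 * (a j).2 + h0.2 * (a j).1 = 0.
  have := hc j _ h0H; rewrite q0 p0 !mulr0 !addr0 /bil sg1 mul1r => <-.
  by ring.
have card_ax (o : option F) : #|line o| = #|F| by apply: card_line.
have fin (o : option F) : (forall w, w \in level a s -> w - 0 \in line o) ->
    fiber_sum a <= q%:R + q%:R^-1.
  by move=> /fiber_sum_subset; rewrite card_ax.
have mulz (x y : F) : x != 0 -> x * y = 0 -> y = 0.
  by move=> x0 /eqP; rewrite mulf_eq0 (negPf x0) => /eqP.
have [h1|h1] := eqVneq h0.1 0.
  have h2 : h0.2 != 0.
    by apply: contraNneq hn => h2; rewrite [h0]surjective_pairing h1 h2.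
  have inl (x : F * F) : x.1 = 0 -> x \in line (None : option F).
    move=> x1; apply/imsetP; exists x.2 => //.
    by rewrite /scl /= mulr0 mulr1 -x1; case: (x).
  exists true; split=> [j|]; first by apply: inl; apply: (mulz _ _ h2); rewrite -(ba j) h1; ring.
  apply: (fin None) => w /Hw0 wH; rewrite subr0; apply: inl.
  have e0 : w0.1 = 0 by apply: (mulz _ _ h2); rewrite -p0 h1; ring.
  have := quadD _ wH; rewrite h1 mul0r add0r => /(mulz _ _ h2) /=.
  by rewrite e0 subr0.
have h2 : h0.2 = 0 by apply: (mulz _ _ h1).
have inl (x : F * F) : x.2 = 0 -> x \in line (Some (0 : F)).
  move=> x1; apply/imsetP; exists x.1 => //.
  by rewrite /scl /= mulr0 mulr1 -x1; case: (x).
exists false; split=> [j|]; first by apply: inl; apply: (mulz _ _ h1); rewrite -(ba j) h2; ring.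
apply: (fin (Some 0)) => w /Hw0 wH; rewrite subr0; apply: inl.
have e0 : w0.2 = 0 by apply: (mulz _ _ h1); rewrite -p0 h2; ring.
have := quadD _ wH; rewrite h2 mul0r addr0 => /(mulz _ _ h1) /=.
by rewrite e0 subr0.
Qed.

(** For [kap = 0] constant phases mean that every [a j] annihilates [H]. The alternatives are the
    three kinds of subspaces, and any line may occur. *)
Lemma fiber_sum_cases_alternating (kap0 : kap = 0) (a : {ffun 'I_m -> F * F}) :
  [\/ exists tc, growing a tc, exists p, losing a p |
   [\/ fiber_sum a <= 1 + q%:R^-1, forall j, a j = 0 |
   exists o, (forall j, a j \in annihilator sg (line o)) /\
     fiber_sum a <= q%:R + q%:R^-1]].
Proof.
have [h1|h2|[H [w0 [HH Hw0 hc _]]]] := fiber_sum_cases a;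
  [by constructor 1|by constructor 2|constructor 3].
have ann j : a j \in annihilator sg H.
  apply/annihilatorP => h /(hc j); by rewrite kap0 !mul0r !addr0.
have := fiber_sum_subset Hw0; have [HE|[HE|[ o HE]]] := subspace_cases HH.
- by rewrite HE cards1; constructor 1.
- move=> _; constructor 2 => j.
  have /annihilatorP h := ann j; rewrite [a j]surjective_pairing; congr pair.
    have := h (0, 1); rewrite HE finset.in_setT => /(_ isT).
    rewrite /bil /= mul0r add0r mul1r => /eqP.
    by rewrite mulf_eq0 (negPf sg_neq0) => /eqP.
  have := h (1, 0); rewrite HE finset.in_setT => /(_ isT).
  by rewrite /bil /= mul1r mul0r mulr0 addr0.
- rewrite HE card_line => hf; constructor 3; exists o; split => // j.
  by rewrite -HE.
Qed.

End Bounds.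
End Configurations.

(** * Sums over configurations *)

Lemma add3_le_mul (n : nat) : (3 <= n -> 2 + n.+1 <= n ^ 2)%N.
Proof. by move=> n3; rewrite -mulnn; nia. Qed.

Section Totals.
Variables (R : realType) (F : finFieldType) (alpha : R) (ph psi : F -> R).
Hypotheses (alpha_gt0 : 0 < alpha) (alpha_le1 : alpha <= 1).
Hypothesis prof : decay_profile alpha ph psi.
Hypothesis two_neq0 : 2 != 0 :> F.
Hypothesis F_nat : forall t : F, exists k : nat, t = k%:R.
Variables (sg kap gam : F).
Hypothesis sg_neq0 : sg != 0.
Variables (m m' : nat) (s : R) (k r e : nat).
Hypotheses (s_ge0 : 0 <= s) (r_gt0 : (0 < r)%N) (e_lt_m : (e < m)%N).
Hypotheses (m_le : (m <= m')%N) (m'_le : (m' <= m.+1)%N) (m'_le_q : (m' <= #|F|)%N).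
Hypothesis tail_le : #|F|%:R ^+ 2 * expR (- (s / 2)) <= #|F|%:R^-1.
Hypothesis sample_large : #|F|%:R ^+ 2 < expR (alpha / 8 * r%:R).
Hypothesis growth_large : 8 <= (alpha / 2) ^+ 2 * (3 / 2) ^+ k.
Hypothesis exceptions_le : 4 ^+ k.+1 * s <= e%:R * (alpha / 16).
Hypothesis q_large : #|F|%:R^-1 <= alpha / 16.
Hypothesis few_exceptions :
  (#|F| ^ (3 * r + 2 * e + 5) * m.+1 ^ e)%:R * (1 - alpha / 16) ^+ m' <= 1.

Local Notation q := (#|F|).
Local Notation fs := (fiber_sum ph sg kap gam).
Local Notation config := {ffun 'I_m -> F * F}.
Local Notation rho := (1 - alpha / 16).
Local Notation growing := (growing alpha ph psi sg kap gam e).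
Local Notation losing := (losing alpha ph sg kap gam e).

Let q_gt0 : 0 < q%:R :> R.
Proof. by rewrite ltr0n; apply/card_gt0P; exists 0. Qed.

Let q_ge3 : (3 <= q)%N.
Proof.
have : (16 : R) <= q%:R.
  rewrite -(ler_pM2l (_ : 0 < alpha / 16)) ?divr_gt0 //.
  have : q%:R^-1 * q%:R <= alpha / 16 * q%:R by rewrite ler_wpM2r // ltW.
  by rewrite mulVf ?gt_eqF //; move: alpha_le1; lra.
by rewrite ler_nat; apply: leq_trans.
Qed.

Let rho_gt0 : 0 < rho. Proof. by move: alpha_le1; lra. Qed.

Lemma fs_ge0 (a : config) : 0 <= fs a :> R.
Proof. exact: (fiber_sum_ge0 prof). Qed.

(** Counting configurations gives [#|X| ^ m], the bound on the fiber sum gives [#|X|] in the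
    denominator [m'] times; since [m <= m'] the size of [X] disappears. *)
Lemma sum_few_outside (X : {set F * F}) (B : R) (P : pred config) :
  (0 < #|X|)%N -> 0 <= B ->
  (forall a, P a -> (outside a X <= e)%N /\ fs a * #|X|%:R <= B) ->
  \sum_(a | P a) fs a ^+ m' <= (m.+1 ^ e * (q ^ 2) ^ e)%:R * B ^+ m'.
Proof.
move=> X0 B0 hP; have X0' : 0 < #|X|%:R :> R by rewrite ltr0n.
apply: le_trans (@sum_pred_le _ _ P _ ((B / #|X|%:R) ^+ m') _ _
  (leq_trans _ (card_few_outside m e X0)) _) _.
- by rewrite exprn_ge0 // divr_ge0.
- by apply: subset_leq_card; apply/fintype.subsetP => a; rewrite !inE => /hP[].
- move=> a /hP[_ h]; rewrite lerXn2r ?nnegrE ?fs_ge0 ?divr_ge0 //.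
  by rewrite ler_pdivlMr.
rewrite natrM -mulrA ler_wpM2l // expr_div_n mulrCA ler_piMr ?exprn_ge0 //.
rewrite ler_pdivrMr ?exprn_gt0 // mul1r natrX ler_weXn2l // ler1n.
exact: X0.
Qed.

Lemma sum_growing (tc : {ffun 'I_r -> (F * F) * F}) :
  \sum_(a : config | growing a tc) fs a ^+ m' <=
    (m.+1 ^ e * (q ^ 2) ^ e)%:R * (q%:R ^+ 2 * rho) ^+ m'.
Proof.
have [X0|X0] := posnP #|sample_set alpha psi sg tc|.
  (* With an empty sample set all [m] indices would be exceptional, against [e < m]. *)
  rewrite big_pred0 ?mulr_ge0 ?exprn_ge0 ?mulr_ge0 ?exprn_ge0 // ?ltW // => a.
  apply: contraTF e_lt_m => /andP[h _]; rewrite -leqNgt; apply: leq_trans h.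
  rewrite -[leqLHS]card_ord; apply: subset_leq_card; apply/fintype.subsetP => j _.
  by rewrite inE; move/eqP: X0; rewrite cards_eq0 => /eqP ->; rewrite inE.
apply: sum_few_outside X0 _ _; first by rewrite mulr_ge0 ?exprn_ge0 // ltW.
move=> a /andP[h1 h2]; split => //; apply: le_trans h2 _.
by rewrite ler_wpM2l ?exprn_ge0 //; move: alpha_le1; lra.
Qed.

Lemma sum_losing p :
  \sum_(a : config | losing a p) fs a ^+ m' <=
    (m.+1 ^ e * (q ^ 2) ^ e)%:R * (q%:R ^+ 2 * rho) ^+ m'.
Proof.
set H := plane_subspace p.1.
have HH : subspace H by apply: plane_subspaceP.
have card_coset : #|annihilator_coset sg H p.2| = #|annihilator sg H|.
  rewrite -(card_translate (annihilator sg H) p.2); apply: eq_card => x.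
  rewrite inE; apply/idP/imsetP => [h|[t tA ->]]; last by rewrite addrC addrA addNr add0r.
  by exists (x - p.2) => //; rewrite addrC subrK.
have ann0 : (0 < #|annihilator sg H|)%N.
  by apply/card_gt0P; exists 0; apply/annihilatorP => h _; apply: bil0r.
apply: (@sum_few_outside (annihilator_coset sg H p.2)).
- by rewrite card_coset.
- by rewrite mulr_ge0 ?exprn_ge0 // ltW.
move=> a /andP[h1 h2]; split => //; rewrite card_coset.
apply: (@le_trans _ _ (#|H|%:R * rho * #|annihilator sg H|%:R)); first by rewrite ler_wpM2r.
rewrite mulrAC ler_wpM2r ?(ltW rho_gt0) // -natrM -natrX ler_nat.
exact: card_annihilator.
Qed.

(** There are [q ^ (3 * r)] samples and at most [q ^ 4] pairs of a subspace and a shift. The [5] in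
    [few_exceptions] is this [4] plus one factor [q], which brings [q ^ (2 * m')] down to at most
    [q ^ (m + m')]. *)
Lemma sum_exceptional :
  \sum_tc \sum_(a : config | growing a (tc : {ffun 'I_r -> (F * F) * F})) fs a ^+ m' +
  \sum_p \sum_(a : config | losing a p) fs a ^+ m' <= 2 * q%:R ^+ (m + m').
Proof.
set T := (m.+1 ^ e * (q ^ 2) ^ e)%:R * (q%:R ^+ 2 * rho) ^+ m'.
have T0 : 0 <= T by rewrite mulr_ge0 ?exprn_ge0 ?mulr_ge0 ?exprn_ge0 // ltW.
apply: (@le_trans _ _ ((q ^ (3 * r + 4))%:R * T + (q ^ (3 * r + 4))%:R * T)).
  apply: lerD.
    apply: le_trans (ler_sum _ (fun tc _ => sum_growing tc)) _.
    rewrite sumr_const -(mulr_natl T) ler_wpM2r // ler_nat card_ffun card_ord !card_prod.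
    have -> : (q * q * q = q ^ 3)%N by rewrite !expnS expn0 muln1 mulnA.
    rewrite -expnM leq_pexp2l ?leq_addr //.
    exact: leq_trans q_ge3.
  apply: le_trans (ler_sum _ (fun p _ => sum_losing p)) _.
  rewrite sumr_const -(mulr_natl T) ler_wpM2r // ler_nat card_prod card_sum card_bool.
  rewrite card_option card_prod.
  apply: (@leq_trans (q ^ 4)); last by rewrite leq_pexp2l ?leq_addl //; exact: leq_trans q_ge3.
  by rewrite (expnD _ 2 2) leq_mul // add3_le_mul.
rewrite -mulr2n -(mulr_natl (_ * T)) ler_wpM2l //.
have -> : (q ^ (3 * r + 4))%:R * T =
    ((q ^ (3 * r + 2 * e + 5) * m.+1 ^ e)%:R * rho ^+ m') * (q%:R ^+ (2 * m') / q%:R).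
  rewrite /T exprMn -exprM !natrM !natrX -!exprM !exprD; field.
  by rewrite gt_eqF.
apply: (@le_trans _ _ (1 * (q%:R ^+ (2 * m') / q%:R))).
  by rewrite ler_wpM2r // divr_ge0 // exprn_ge0.
rewrite mul1r ler_pdivrMr // -exprSr ler_weXn2l ?ler1n //; first exact: leq_trans q_ge3.
by clear -m_le m'_le; lia.
Qed.

(** The tails compound to [(1 + q^-1) ^ m'], which stays below [expR 1] because [m' <= q]. *)
Lemma sum_bounded (P : pred config) N (b : R) : (#|P| <= N)%N -> 0 <= b ->
  (forall a, P a -> fs a <= b + b * q%:R^-1) ->
  \sum_(a | P a) fs a ^+ m' <= N%:R * (b ^+ m' * expR 1).
Proof.
move=> PN b0 hP; apply: sum_pred_le => //; first by rewrite mulr_ge0 ?exprn_ge0 ?expR_ge0.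
move=> a /hP h; apply: (@le_trans _ _ ((b * (1 + q%:R^-1)) ^+ m')).
  by rewrite lerXn2r ?nnegrE ?fs_ge0 ?mulr_ge0 ?addr_ge0 ?invr_ge0 // mulrDr mulr1.
rewrite exprMn ler_wpM2l ?exprn_ge0 //.
apply: (@le_trans _ _ (expR q%:R^-1 ^+ m')).
  by rewrite lerXn2r ?nnegrE ?addr_ge0 ?invr_ge0 ?expR_ge0 // expR_ge1Dx.
rewrite -expRM_natl ler_expR ler_pdivrMr // mul1r ler_nat.
exact: m'_le_q.
Qed.

Lemma card_ffun_in (X : {set F * F}) (N : nat) : (#|X| <= N)%N ->
  (#|[pred a : config | [forall j, a j \in X]]| <= N ^ m)%N.
Proof.
move=> XN; apply: (@leq_trans (#|X| ^ m)); last by rewrite leq_exp2r //; apply: leq_ltn_trans e_lt_m.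
rewrite -[X in (_ <= _ ^ X)%N]card_ord -card_ffun_on; apply: subset_leq_card.
by apply/fintype.subsetP => a; rewrite inE => /forallP h; apply/ffun_onP.
Qed.

Lemma sum_generic :
  \sum_(a : config | fs a <= 1 + q%:R^-1) fs a ^+ m' <= q%:R ^+ (m + m') * expR 1.
Proof.
apply: le_trans (sum_bounded (N := (q ^ 2) ^ m) _ ler01 _) _.
- apply: leq_trans (max_card _) _; rewrite card_ffun card_ord card_prod.
  by rewrite mulnn.
- by move=> a; rewrite mul1r.
rewrite expr1n mul1r ler_wpM2r ?expR_ge0 // -natrX ler_nat -expnM.
rewrite leq_pexp2l //; first exact: leq_trans q_ge3.
by clear -m_le; lia.
Qed.

Lemma sum_on_line (X : {set F * F}) : (#|X| <= q)%N ->
  \sum_(a : config | [forall j, a j \in X] && (fs a <= q%:R + q%:R^-1)) fs a ^+ m' <=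
    q%:R ^+ (m + m') * expR 1.
Proof.
move=> Xq; apply: le_trans (sum_bounded (N := q ^ m) (b := q%:R) _ _ _) _ => //.
- apply: leq_trans (card_ffun_in Xq); apply: subset_leq_card.
  by apply/fintype.subsetP => a; rewrite !inE => /andP[].
- move=> a /andP[_]; move=> h; apply: le_trans h _; rewrite lerD2l mulfV ?gt_eqF //.
  rewrite invf_le1 // ler1n; exact: leq_trans q_ge3.
by rewrite natrX mulrA -exprD.
Qed.

(** The [2] counts the growing and losing classes, the [3 * expR 1] the generic configurations and
    the two axes. *)
Lemma total_le_site (sg1 : sg = 1) (gam0 : gam != 0) :
  \sum_(a : config) fs a ^+ m' <= (2 + 3 * expR 1) * q%:R ^+ (m + m').
Proof.
have f0 (a : config) : 0 <= fs a ^+ m' by rewrite exprn_ge0 // fs_ge0.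
pose Q1 (a : config) := [exists tc : {ffun 'I_r -> (F * F) * F}, growing a tc].
pose Q2 (a : config) := [exists p, losing a p].
pose Q3 (a : config) := fs a <= 1 + q%:R^-1.
pose M (b : bool) (a : config) :=
  [forall j, a j \in line (if b then None else Some (0 : F))] && (fs a <= q%:R + q%:R^-1).
have cov (a : config) : xpredT a -> Q1 a || (Q2 a || (Q3 a || [exists b, M b a])).
  move=> _; have [[tc h]|[p h]|[h|[b [h1 h2]]]] := fiber_sum_cases_site alpha_gt0 alpha_le1 prof two_neq0
    F_nat kap sg_neq0 s_ge0 r_gt0 e_lt_m tail_le sample_large growth_large exceptions_le
    q_large sg1 gam0 a.
  - by apply/orP; left; apply/existsP; exists tc.
  - by rewrite orbC (_ : Q2 a) //; apply/existsP; exists p.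
  - by rewrite /Q3 h !orbT.
  - rewrite (_ : [exists b, M b a]) ?orbT //; apply/existsP; exists b.
    by rewrite /M h2 andbT; apply/forallP.
apply: le_trans (sum_le_or f0 cov) _.
apply: le_trans (lerD (lexx _) (sum_le_or f0 (fun a h => h))) _.
apply: le_trans (lerD (lexx _) (lerD (lexx _) (sum_le_or f0 (fun a h => h)))) _.
have h1 := sum_le_cover f0 (fun a => elimT existsP : Q1 a -> _).
have h2 := sum_le_cover f0 (fun a => elimT existsP : Q2 a -> _).
have h4 := sum_le_cover f0 (fun a => elimT existsP : [exists b, M b a] -> _).
have h5 := sum_exceptional; have h3 := sum_generic.
have h6 : \sum_b \sum_(a | M b a) fs a ^+ m' <= 2 * (q%:R ^+ (m + m') * expR 1).
  rewrite big_bool mulr_natl mulr2n; apply: lerD; apply: sum_on_line; rewrite card_line //.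
have e0 := expR_ge0 (1 : R).
rewrite /Q3; move: h1 h2 h3 h4 h5 h6; lra.
Qed.

(** The extra factor [q] comes from the [q + 1] lines and from the zero configuration, whose fiber
    sum may be [q ^ 2]; there [2 * m' <= (m + m').+1] is used. *)
Lemma total_le_alternating (kap0 : kap = 0) :
  \sum_(a : config) fs a ^+ m' <= (3 + 3 * expR 1) * q%:R ^+ (m + m').+1.
Proof.
have f0 (a : config) : 0 <= fs a ^+ m' by rewrite exprn_ge0 // fs_ge0.
pose Q1 (a : config) := [exists tc : {ffun 'I_r -> (F * F) * F}, growing a tc].
pose Q2 (a : config) := [exists p, losing a p].
pose Q3 (a : config) := fs a <= 1 + q%:R^-1.
pose Q4 (a : config) := [forall j, a j == 0].
pose M (o : option F) (a : config) :=
  [forall j, a j \in annihilator sg (line o)] && (fs a <= q%:R + q%:R^-1).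
have cov (a : config) : xpredT a -> Q1 a || (Q2 a || (Q3 a || (Q4 a || [exists o, M o a]))).
  move=> _; have [[tc h]|[p h]|[h|h|[ o [h1 h2]]]] := fiber_sum_cases_alternating alpha_gt0
    alpha_le1 prof two_neq0 F_nat gam sg_neq0 s_ge0 r_gt0 e_lt_m tail_le sample_large growth_large exceptions_le
    q_large kap0 a.
  - by apply/orP; left; apply/existsP; exists tc.
  - by rewrite orbC (_ : Q2 a) //; apply/existsP; exists p.
  - by rewrite /Q3 h !orbT.
  - by rewrite (_ : Q4 a) ?orbT //; apply/forallP => j; apply/eqP.
  - rewrite (_ : [exists o, M o a]) ?orbT //; apply/existsP; exists o.
    by rewrite /M h2 andbT; apply/forallP.
apply: le_trans (sum_le_or f0 cov) _.
apply: le_trans (lerD (lexx _) (sum_le_or f0 (fun a h => h))) _.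
apply: le_trans (lerD (lexx _) (lerD (lexx _) (sum_le_or f0 (fun a h => h)))) _.
apply: le_trans (lerD (lexx _) (lerD (lexx _) (lerD (lexx _) (sum_le_or f0 (fun a h => h))))) _.
have h1 := sum_le_cover f0 (fun a => elimT existsP : Q1 a -> _).
have h2 := sum_le_cover f0 (fun a => elimT existsP : Q2 a -> _).
have h4 := sum_le_cover f0 (fun a => elimT existsP : [exists o, M o a] -> _).
have h5 := sum_exceptional; have h3 := sum_generic.
set S := q%:R ^+ (m + m') in h3 h5.
have q3 : 3 <= q%:R :> R by rewrite ler_nat.
have S0 : 0 <= S by rewrite exprn_ge0.
have h6 : \sum_o \sum_(a | M o a) fs a ^+ m' <= q.+1%:R * (S * expR 1).
  rewrite -card_option mulr_natl -sumr_const; apply: ler_sum => o _.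
  apply: sum_on_line; rewrite -(leq_pmul2l (_ : 0 < q)%N); last by rewrite (leq_trans _ q_ge3).
  rewrite -{1}(card_line o) mulnn; apply: card_annihilator => //.
  exact: subspace_line.
have h7 : \sum_(a | Q4 a) fs a ^+ m' <= q%:R * S.
  have h : (#|Q4| <= 1)%N.
    rewrite -(card1 (0 : config)); apply: subset_leq_card.
    apply/fintype.subsetP => a; rewrite !inE => /forallP h.
    by apply/eqP/ffunP => j; rewrite ffunE; apply/eqP.
  apply: le_trans (sum_pred_le (b := (q%:R ^+ 2) ^+ m') _ h _) _; first by rewrite !exprn_ge0.
    move=> a _; rewrite lerXn2r ?nnegrE ?fs_ge0 ?exprn_ge0 //.
    apply: le_trans (ler_sum _ (fun w _ => fiber_term_le1 prof sg kap gam a w)) _.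
    by rewrite sumr_const -natrX card_prod mulnn.
  rewrite mul1r -exprM -exprS ler_weXn2l ?ler1n //; first exact: leq_trans q_ge3.
  by clear -m'_le; lia.
have e0 := expR_ge0 (1 : R).
rewrite exprS -/S /Q3.
have Sq : S <= q%:R * S by rewrite ler_peMl // ; move: q3; lra.
have Se : S * expR 1 <= q%:R * S * expR 1 by rewrite ler_wpM2r.
rewrite -(addn1 q) natrD in h6.
by move: h1 h2 h3 h4 h5 h6 h7 S0 Sq Se; lra.
Qed.

End Totals.

(** * The expected number of kernel vectors *)

Section Splitting.
Variables (R : comPzSemiRingType) (V : finType) (m m' : nat).

Definition join_ffun (p : {ffun 'I_m -> V} * {ffun 'I_m' -> V}) :
    {ffun 'I_(m + m') -> V} :=
  [ffun i => match fintype.split i with inl j => p.1 j | inr k => p.2 k end].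

Definition split_ffun (w : {ffun 'I_(m + m') -> V}) :=
  ([ffun j => w (lshift m' j)], [ffun k => w (rshift m k)]).

Lemma join_ffunK : cancel join_ffun split_ffun.
Proof.
case=> a b; rewrite /split_ffun; congr pair; apply/ffunP => j; rewrite !ffunE.
  by rewrite (unsplitK (inl j)).
by rewrite (unsplitK (inr j)).
Qed.

Lemma split_ffunK : cancel split_ffun join_ffun.
Proof.
move=> w; apply/ffunP => i; rewrite ffunE /= -{2}(splitK i).
by case: (fintype.split i) => j; rewrite ffunE.
Qed.

(** Once the first half is fixed, each factor involves a single point of the second half, so the sum
    over the second half is a power. *)
Lemma sum_split_ffun (f : {ffun 'I_m -> V} -> V -> R) :
  \sum_(w : {ffun 'I_(m + m') -> V})
    \prod_(k < m') f [ffun j => w (lshift m' j)] (w (rshift m k)) =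
  \sum_a (\sum_v f a v) ^+ m'.
Proof.
rewrite (reindex join_ffun) /=; last first.
  by exists split_ffun => ? _; [apply: join_ffunK|apply: split_ffunK].
rewrite -(pair_bigA _ (fun a b => \prod_(k < m') f
  [ffun j => join_ffun (a, b) (lshift m' j)] (join_ffun (a, b) (rshift m k)))) /=.
apply: eq_bigr => a _.
transitivity (\sum_(b : {ffun 'I_m' -> V}) \prod_(k < m') f a (b k)).
  apply: eq_bigr => b _; apply: eq_bigr => k _.
  have [-> e2] : split_ffun (join_ffun (a, b)) = (a, b) by apply: join_ffunK.
  by move/ffunP/(_ k): e2; rewrite ffunE => ->.
by rewrite -(bigA_distr_bigA (fun (k : 'I_m') v => f a v)) prodr_const card_ord.
Qed.

End Splitting.

Section ExpectedKernel.
Variables (R : realType) (F : finFieldType) (co si : F -> R).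
Hypothesis chi : additive_character co si.
Variable mu : F -> R.
Local Notation C := R[i].
Local Notation Re := (@complex.Re R).

Definition cchi (t : F) : C := Complex (co t) (si t).

Lemma cchi0 : cchi 0 = 1.
Proof. by rewrite /cchi (co0 chi) (si0 chi). Qed.

Lemma cchiD x y : cchi (x + y) = cchi x * cchi y.
Proof. by rewrite /cchi (coD chi) (siD chi). Qed.

Lemma cchi_sum (I : finType) (P : pred I) (f : I -> F) :
  cchi (\sum_(i | P i) f i) = \prod_(i | P i) cchi (f i).
Proof. exact: (big_morph cchi cchiD cchi0). Qed.

Lemma Re_sum (I : finType) (P : pred I) (f : I -> C) :
  Re (\sum_(i | P i) f i) = \sum_(i | P i) Re (f i).
Proof. by apply: (big_morph Re (op1 := +%R)) => // -[? ?] []. Qed.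

Lemma Im_sum (I : finType) (P : pred I) (f : I -> C) :
  complex.Im (\sum_(i | P i) f i) = \sum_(i | P i) complex.Im (f i).
Proof. by apply: (big_morph (@complex.Im R) (op1 := +%R)) => // -[? ?] []. Qed.

Lemma sum_cchi a : \sum_t cchi (t * a) = ((a == 0)%:R * #|F|%:R)%:C%C.
Proof.
under eq_bigr do rewrite mulrC.
have [->|a0] /= := eqVneq a 0.
  under eq_bigr do rewrite mul0r cchi0.
  by rewrite sumr_const mul1r rmorph_nat.
rewrite mul0r; apply/eqP; rewrite eq_complex Re_sum Im_sum /=.
by rewrite (sum_co chi) // (sum_si chi) // !eqxx.
Qed.

Lemma sum_co_dot n (y : 'I_n -> F) :
  \sum_(u : {ffun 'I_n -> F}) co (\sum_i u i * y i) =
    [forall i, y i == 0]%:R * #|F|%:R ^+ n.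
Proof.
transitivity (Re (\sum_(u : {ffun 'I_n -> F}) cchi (\sum_i u i * y i))).
  by rewrite Re_sum.
under eq_bigr do rewrite cchi_sum.
rewrite -(bigA_distr_bigA (fun i t => cchi (t * y i))) /=.
under eq_bigr do rewrite sum_cchi.
rewrite -(rmorph_prod (real_complex R)) /= big_split /= prodr_const card_ord; congr (_ * _).
have [/forallP h|/forallPn[i hi]] := boolP [forall i, y i == 0].
  by rewrite big1 // => i _; rewrite h.
by rewrite (bigD1 i) //= (negPf hi) mul0r.
Qed.

Lemma char_norm_cchi t :
  Normc.normc (\sum_r (mu r)%:C%C * cchi (r * t)) = char_norm co si mu t.
Proof.
have -> : \sum_r (mu r)%:C%C * cchi (r * t) =
    Complex (char_co co mu t) (char_si si mu t).
  apply/eqP; rewrite eq_complex Re_sum Im_sum /=; apply/andP; split; apply/eqP.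
    by apply: eq_bigr => r _; rewrite /= mul0r subr0.
  by apply: eq_bigr => r _; rewrite /= mul0r addr0.
by [].
Qed.

Variables (K : finType) (D : {pred K}).

Definition law_prob (x : {ffun K -> F}) : R := \prod_(k in D) mu (x k).

(** The expectation is the real part of a product of characteristic functions. Summing over
    [pfamily 0 D] fixes the coordinates outside [D] at zero, so each outcome on [D] is counted
    once. *)
Lemma expected_co (L : K -> F) :
  \sum_(x in pfamily 0 D (fun=> predT)) law_prob x * co (\sum_(k in D) x k * L k) <=
    \prod_(k in D) char_norm co si mu (L k).
Proof.
have -> : \sum_(x in pfamily 0 D (fun=> predT)) law_prob x * co (\sum_(k in D) x k * L k) =
    Re (\prod_(k in D) \sum_r (mu r)%:C%C * cchi (r * L k)).
  rewrite (big_distr_big 0 (mem D) xpredT (fun k r => (mu r)%:C%C * cchi (r * L k))) Re_sum.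
  apply: eq_bigr => x _.
  rewrite big_split /= -cchi_sum -(rmorph_prod (real_complex R)) /= mul0r subr0.
  by rewrite /law_prob.
apply: (@le_trans _ _ (Normc.normc (\prod_(k in D) \sum_r (mu r)%:C%C * cchi (r * L k)))).
  case: (\prod_(k in D) _) => a b /=.
  apply: (le_trans (ler_norm a)); rewrite -sqrtr_sqr ler_sqrt ?lerDl ?addr_ge0 ?sqr_ge0 //.
rewrite (big_morph (@Normc.normc R) (@Normc.normcM R) (Normc.normc1 R)).
by under eq_bigr do rewrite char_norm_cchi.
Qed.

(* Fourier inversion on the equations [M x *m v = 0] turns the expected number
   of kernel vectors into a sum over pairs [w i = (u i, v i)] of vectors. *)
Lemma expected_kernel n (M : {ffun K -> F} -> 'M[F]_n)
    (L : K -> {ffun 'I_n -> F * F} -> F) :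
  (forall x (w : {ffun 'I_n -> F * F}), \sum_i (w i).1 * (\sum_j M x i j * (w j).2) =
               \sum_(k in D) x k * L k w) ->
  #|F|%:R ^+ n * \sum_(x in pfamily 0 D (fun=> predT))
      law_prob x * #|[set v : 'cV[F]_n | M x *m v == 0]|%:R <=
    \sum_w \prod_(k in D) char_norm co si mu (L k w).
Proof.
move=> ML.
apply: (@le_trans _ _ (\sum_(x in pfamily 0 D (fun=> predT))
   law_prob x * \sum_(w : {ffun 'I_n -> F * F}) co (\sum_(k in D) x k * L k w))).
  rewrite mulr_sumr le_eqVlt; apply/orP; left; apply/eqP; apply: eq_bigr => x _.
  rewrite mulrCA; congr (_ * _).
  under eq_bigr do rewrite -ML.
  pose pr (p : {ffun 'I_n -> F} * {ffun 'I_n -> F}) : {ffun 'I_n -> F * F} :=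
    [ffun i => (p.1 i, p.2 i)].
  rewrite (reindex pr) /=; last first.
    exists (fun w => ([ffun i => (w i).1], [ffun i => (w i).2])) => [[u v]|w] _.
      by congr pair; apply/ffunP => i; rewrite !ffunE.
    by apply/ffunP => i; rewrite !ffunE -surjective_pairing.
  rewrite -(pair_bigA _ (fun u v => co (\sum_i (pr (u, v) i).1 *
    (\sum_j M x i j * (pr (u, v) j).2)))) exchange_big /=.
  transitivity (\sum_(v : {ffun 'I_n -> F})
      [forall i, (\sum_j M x i j * v j) == 0]%:R * (#|F|%:R ^+ n : R)).
    rewrite -mulr_suml mulrC; congr (_ * _).
    rewrite -natr_sum; congr _%:R; rewrite -sum1_card.
    rewrite (reindex (fun v : {ffun 'I_n -> F} => \col_i v i)) /=; last first.
      exists (fun v : 'cV[F]_n => [ffun i => v i 0]) => [v|v] _.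
        by apply/ffunP => i; rewrite ffunE mxE.
      by apply/matrixP => i j; rewrite mxE ffunE ord1.
    rewrite big_mkcond /=; apply: eq_bigr => v _; rewrite inE.
    have -> : (M x *m (\col_i v i) == 0) = [forall i, \sum_j M x i j * v j == 0].
      apply/eqP/forallP => [/matrixP h i|h].
        have h0 := h i 0; rewrite !mxE in h0; apply/eqP; rewrite -[RHS]h0.
        by apply: eq_bigr => j _; rewrite mxE.
      apply/matrixP => i j; rewrite !mxE -[RHS](eqP (h i)).
      by apply: eq_bigr => l _; rewrite mxE.
    by case: ifP.
  apply: eq_bigr => v _; rewrite -sum_co_dot; apply: eq_bigr => u _; congr co.
  apply: eq_bigr => i _; rewrite ffunE /=; congr (_ * _).
  by apply: eq_bigr => j _; rewrite ffunE.
under eq_bigr do rewrite mulr_sumr.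
rewrite exchange_big /=; apply: ler_sum => w _.
exact: expected_co.
Qed.

End ExpectedKernel.

(** * The three matrix models *)

Lemma prod_le_injective (R : realDomainType) (I J : finType) (P : pred I)
    (h : J -> I) (f : I -> R) : injective h -> (forall j, P (h j)) ->
  (forall i, 0 <= f i <= 1) -> \prod_(i | P i) f i <= \prod_j f (h j).
Proof.
move=> hinj hP f01.
rewrite (bigID (mem (h @: [set: J]))) /=.
have -> : \prod_(i | P i && (i \in h @: [set: J])) f i = \prod_j f (h j).
  rewrite (eq_bigl (mem (h @: [set: J]))) => [|i].
    rewrite big_imset /=; last by move=> ? ? _ _; apply: hinj.
    by apply: eq_bigl => j; rewrite inE.
  by apply/andP/idP => [[]|ih] //; split=> //; case/imsetP: ih => j _ ->.
rewrite ler_piMr ?prodr_ge0 => // [j _|]; first by case/andP: (f01 (h j)).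
exact: prodr_ile1.
Qed.

Section PairSums.
Variables (R : pzRingType) (n : nat).

Lemma sum_pairs_below (E : 'I_n -> 'I_n -> R) :
  \sum_i \sum_j E i j =
  \sum_(p in below_diag n) (E p.1 p.2 + E p.2 p.1) + \sum_i E i i.
Proof.
rewrite pair_bigA /= (bigID (fun p : 'I_n * 'I_n => p.2 < p.1)%N) /= big_split /=.
rewrite -addrA; congr (_ + _).
rewrite (bigID (fun p : 'I_n * 'I_n => p.1 < p.2)%N) /=; congr (_ + _).
  rewrite (reindex_inj (inv_inj (fun p : 'I_n * 'I_n => match p with (a, b) => erefl end
    : (fun p : 'I_n * 'I_n => (p.2, p.1)) ((fun p => (p.2, p.1)) p) = p))) /=.
  apply: eq_bigl => p; rewrite unfold_in /below_diag /=.
  by case: ltngtP.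
rewrite (reindex_onto (fun i => (i, i)) (fun p => p.1)) /=.
  by apply: eq_bigl => i; rewrite ltnn eqxx.
case=> i j /andP[]; rewrite -!leqNgt /= => ij ji; congr (_, _).
by apply: val_inj; apply/eqP; rewrite eqn_leq ij ji.
Qed.

Lemma sum_on_or_below (f : 'I_n * 'I_n -> R) :
  \sum_(p in on_or_below_diag n) f p =
  \sum_(p in below_diag n) f p + \sum_i f (i, i).
Proof.
rewrite (bigID (fun p : 'I_n * 'I_n => p.2 < p.1)%N) /=; congr (_ + _).
  apply: eq_bigl => p; rewrite !unfold_in /on_or_below_diag /below_diag.
  by case: ltngtP.
rewrite (reindex_onto (fun i => (i, i)) (fun p => p.1)) /=.
  by apply: eq_bigl => i; rewrite unfold_in /on_or_below_diag /= leqnn ltnn eqxx.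
case=> i j /andP[]; rewrite -leqNgt /= => ij ji; congr (_, _).
by apply: val_inj; apply/eqP; rewrite eqn_leq ji; exact: ij.
Qed.

Lemma sum_above (f : 'I_n * 'I_n -> R) :
  \sum_(p in above_diag n) f p = \sum_(p in below_diag n) f (p.2, p.1).
Proof.
by rewrite (reindex_inj (inv_inj (fun p : 'I_n * 'I_n => match p with (a, b) => erefl end
    : (fun p : 'I_n * 'I_n => (p.2, p.1)) ((fun p => (p.2, p.1)) p) = p))).
Qed.

End PairSums.

Section Matrices.
Variable F : finFieldType.

Definition skew_matrix n (x : {ffun 'I_n * 'I_n -> F}) : 'M[F]_n :=
  \matrix_(i, j) if (j < i)%N then x (i, j)
                 else if (i < j)%N then - x (j, i) else 0.

Definition sym_matrix n (x : {ffun 'I_n * 'I_n -> F}) : 'M[F]_n :=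
  \matrix_(i, j) if (j <= i)%N then x (i, j) else x (j, i).

Definition edge_value n (x : {ffun 'I_n * 'I_n -> F}) (i j : 'I_n) : F :=
  if (i < j)%N then x (i, j) else x (j, i).

Definition laplacian_matrix n (x : {ffun 'I_n.+1 * 'I_n.+1 -> F}) : 'M[F]_n :=
  \matrix_(i, j)
    let i' := widen_ord (leqnSn n) i in
    let j' := widen_ord (leqnSn n) j in
    if i == j then - \sum_(k < n.+1 | k != i') edge_value x k i'
    else edge_value x i' j'.

(** The removed vertex is kept with the point [0], so that all edges have the same form. *)
Definition extend0 n (w : {ffun 'I_n -> F * F}) (i : 'I_n.+1) : F * F :=
  if unlift ord_max i is Some j then w j else 0.

Lemma skew_matrix_form n (x : {ffun 'I_n * 'I_n -> F}) (w : {ffun 'I_n -> F * F}) :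
  \sum_i (w i).1 * (\sum_j skew_matrix x i j * (w j).2) =
  \sum_(p in below_diag n) x p * bil (-1) (w p.1) (w p.2).
Proof.
under eq_bigr do rewrite mulr_sumr.
rewrite sum_pairs_below [X in _ + X]big1 ?addr0; last first.
  by move=> i _; rewrite mxE ltnn mul0r mulr0.
apply: eq_bigr => -[i j] /=; rewrite unfold_in /below_diag /= => ji.
by rewrite !mxE ji ltnNge (ltnW ji) /= /bil; ring.
Qed.

Lemma sym_matrix_form n (x : {ffun 'I_n * 'I_n -> F}) (w : {ffun 'I_n -> F * F}) :
  \sum_i (w i).1 * (\sum_j sym_matrix x i j * (w j).2) =
  \sum_(p in on_or_below_diag n)
    x p * (if p.1 == p.2 then quad (w p.1) else bil 1 (w p.1) (w p.2)).
Proof.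
under eq_bigr do rewrite mulr_sumr.
rewrite sum_pairs_below sum_on_or_below; congr (_ + _).
  apply: eq_bigr => -[i j] /=; rewrite unfold_in /below_diag /= => ji.
  by rewrite !mxE (ltnW ji) leqNgt ji /= -val_eqE gtn_eqF // /bil; ring.
by apply: eq_bigr => i _; rewrite mxE leqnn eqxx /quad; ring.
Qed.

Lemma edge_valueC n (x : {ffun 'I_n * 'I_n -> F}) i j :
  edge_value x i j = edge_value x j i.
Proof. by rewrite /edge_value; case: ltngtP => // /val_inj ->. Qed.

Lemma extend0_widen n (w : {ffun 'I_n -> F * F}) i :
  extend0 w (widen_ord (leqnSn n) i) = w i.
Proof.
rewrite /extend0; have -> : widen_ord (leqnSn n) i = lift ord_max i.
  by apply: val_inj; rewrite /= /bump leqNgt ltn_ord.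
by rewrite liftK.
Qed.

Lemma extend0_max n (w : {ffun 'I_n -> F * F}) : extend0 w ord_max = 0.
Proof. by rewrite /extend0 unlift_none. Qed.

(** Over all vertices the form is the sum of [x i j * u i * (v j - v i)]; the terms [(i, j)] and
    [(j, i)] add up to the pairing of one edge. *)
Lemma laplacian_matrix_form n (x : {ffun 'I_n.+1 * 'I_n.+1 -> F})
    (w : {ffun 'I_n -> F * F}) :
  \sum_i (w i).1 * (\sum_j laplacian_matrix x i j * (w j).2) =
  \sum_(p in above_diag n.+1)
    x p * pairing 1 (-1) (extend0 w p.1) (extend0 w p.2).
Proof.
pose u i := (extend0 w i).1; pose v i := (extend0 w i).2.
pose E i j := edge_value x i j * u i * (v j - v i).
have EE : \sum_i \sum_j E i j = \sum_(p in above_diag n.+1)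
    x p * pairing 1 (-1) (extend0 w p.1) (extend0 w p.2).
  rewrite sum_pairs_below [X in _ + X]big1 ?addr0; last first.
    by move=> i _; rewrite /E subrr mulr0.
  rewrite sum_above; apply: eq_bigr => -[i j]; rewrite unfold_in /below_diag /= => ji.
  rewrite /E (edge_valueC x i j) /edge_value ji /pairing /bil /quad /u /v.
  by ring.
rewrite -EE big_ord_recr /= [X in _ + X]big1 ?addr0; last first.
  by move=> j _; rewrite /E /u extend0_max /= mulr0 mul0r.
apply: eq_bigr => i _; set W := widen_ord (leqnSn n).
have uW l : u (W l) = (w l).1 by rewrite /u extend0_widen.
have vW l : v (W l) = (w l).2 by rewrite /v extend0_widen.
rewrite (bigD1 i) //= mxE /= eqxx -/(W i).
have -> : \sum_j E (W i) j =
    \sum_(j | j != W i) edge_value x j (W i) * u (W i) * v j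
    - (\sum_(j | j != W i) edge_value x j (W i)) * (u (W i) * v (W i)).
  rewrite (bigD1 (W i)) //= {1}/E subrr mulr0 add0r mulr_suml -sumrB.
  by apply: eq_bigr => j _; rewrite /E (edge_valueC x (W i)); ring.
rewrite -uW -vW mulrDr addrC; congr (_ + _); last by ring.
rewrite [RHS]big_mkcond big_ord_recr /= {2}/v extend0_max /= mulr0 if_same addr0.
rewrite mulr_sumr big_mkcond; apply: eq_bigr => j _.
rewrite -!val_eqE /=; case: eqVneq => //= ji.
rewrite mxE /= -val_eqE eq_sym (negPf ji) -/(W i) -/(W j) -vW (edge_valueC x (W j)).
by ring.
Qed.

Lemma card_kernel_singular n (M : 'M[F]_n) : \det M = 0 ->
  (#|F| <= #|[set v : 'cV[F]_n | M *m v == 0%R]|)%N.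
Proof.
rewrite -det_tr => /eqP/det0P[v v0 vM].
have Mv : M *m v^T = 0 by rewrite -[M]trmxK -trmx_mul vM trmx0.
have /rV0Pn[i vi] := v0.
have inj : injective (fun t : F => t *: v^T).
  by move=> s t /matrixP/(_ i 0); rewrite !mxE => /(mulIf vi).
rewrite -(card_imset F inj); apply: subset_leq_card.
by apply/fintype.subsetP => _ /imsetP[t _ ->]; rewrite inE -scalemxAr Mv scaler0.
Qed.

Lemma det_odd_skew n (M : 'M[F]_n) : 2 != 0 :> F -> odd n -> M^T = - M -> \det M = 0.
Proof.
move=> two0 on MT; have := det_tr M.
rewrite MT -scaleN1r detZ -signr_odd on expr1 mulN1r => /eqP.
rewrite eq_sym -subr_eq0 opprK -mulr2n -mulr_natl mulf_eq0 (negPf two0) /=.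
by move/eqP.
Qed.

(* Deleting a row and column where the kernel vector [v] does not vanish leaves
   an odd skew matrix; a kernel vector of it extends by zero. *)
Lemma card_kernel_singular_skew n (M : 'M[F]_n) : 2 != 0 :> F -> ~~ odd n ->
  M^T = - M -> \det M = 0 -> (#|F| ^ 2 <= #|[set v : 'cV[F]_n | M *m v == 0%R]|)%N.
Proof.
move=> two0 en MT; rewrite -det_tr => /eqP/det0P[v v0 vM].
have Mv : M *m v^T = 0 by rewrite -[M]trmxK -trmx_mul vM trmx0.
have /rV0Pn[i vi] := v0.
case: n => [|n] in M en MT v v0 vM Mv i vi *; first by case: i {vi}.
pose M' := row' i (col' i M).
have M'T : M'^T = - M'.
  by apply/matrixP => k l; have /matrixP/(_ (lift i k) (lift i l)) := MT; rewrite !mxE.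
have /eqP/det0P[u' u'0 uM'] : \det M'^T = 0.
  by rewrite det_tr; apply: det_odd_skew => //; move: en => /=; rewrite negbK.
have /rV0Pn[j uj] := u'0.
pose u : 'cV[F]_n.+1 := \col_k (if unlift i k is Some l then u' 0 l else 0).
have ui : u i 0 = 0 by rewrite mxE unlift_none.
have ul l : u (lift i l) 0 = u' 0 l by rewrite mxE liftK.
have Mul l : (M *m u) (lift i l) 0 = 0.
  have M'u : M' *m u'^T = 0 by rewrite -[M']trmxK -trmx_mul uM' trmx0.
  have /matrixP/(_ l 0) := M'u; rewrite [in X in X -> _]mxE [in X in X -> _]mxE => <-.
  rewrite mxE (bigD1_ord i) //= ui mulr0 add0r.
  by apply: eq_bigr => k _; rewrite ul !mxE.
(* The remaining row follows from the others: [v] annihilates [M] on the left by skewness, and its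
   entry at [i] is nonzero. *)
have Mui : (M *m u) i 0 = 0.
  have : (v *m (M *m u)) 0 0 = 0.
    have vM' : v *m M = 0.
      have := vM; rewrite MT mulmxN => /eqP; rewrite oppr_eq0 => /eqP //.
    by rewrite mulmxA vM' mul0mx mxE.
  rewrite mxE (bigD1_ord i) //= big1 ?addr0 => [|l _]; last by rewrite Mul mulr0.
  by move/eqP; rewrite mulf_eq0 (negPf vi) /= => /eqP.
have Mu : M *m u = 0.
  apply/matrixP => k z; rewrite (ord1 z) [RHS]mxE.
  by have [l ->|->] := unliftP i k.
have inj : injective (fun p : F * F => p.1 *: v^T + p.2 *: u).
  move=> [s1 t1] [s2 t2] /= e.
  have es : s1 = s2.
    have /matrixP/(_ i 0) := e; rewrite !mxE unlift_none !mulr0 !addr0.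
    by move/(mulIf vi).
  congr pair => //; move: e; rewrite es => /addrI /matrixP/(_ (lift i j) 0).
  by rewrite !mxE liftK => /(mulIf uj).
rewrite -mulnn -card_prod -(card_imset _ inj); apply: subset_leq_card.
apply/fintype.subsetP => _ /imsetP[t _ ->].
by rewrite inE mulmxDr -!scalemxAr Mv Mu !scaler0 addr0.
Qed.

Section Products.
Variables (R : realType) (alpha : R) (ph psi : F -> R).
Hypothesis prof : decay_profile alpha ph psi.
Variables (m m' : nat) (w : {ffun 'I_(m + m') -> F * F}).

Let ph01 t : 0 <= ph t <= 1.
Proof. by rewrite (ph_ge0 prof) (ph_le1 prof). Qed.

Lemma prod_skew_le :
  \prod_(p in below_diag (m + m')) ph (bil (-1) (w p.1) (w p.2)) <=
  \prod_(k < m') (site ph 0 (w (rshift m k)) *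
    \prod_(j < m) ph (pairing (-1) 0 (w (rshift m k)) ([ffun j => w (lshift m' j)] j))).
Proof.
have -> : \prod_(k < m') (site ph 0 (w (rshift m k)) *
    \prod_(j < m) ph (pairing (-1) 0 (w (rshift m k)) ([ffun j => w (lshift m' j)] j))) =
    \prod_(s : 'I_m' * 'I_m) ph (bil (-1) (w (rshift m s.1)) (w (lshift m' s.2))).
  rewrite -(pair_bigA _ (fun k j => ph (bil (-1) (w (rshift m k)) (w (lshift m' j))))) /=.
  apply: eq_bigr => k _; rewrite /site mul0r (ph0 prof) mul1r.
  by apply: eq_bigr => j _; rewrite ffunE /pairing !mul0r !addr0.
pose h (s : 'I_m' * 'I_m) : 'I_(m + m') * 'I_(m + m') := (rshift m s.1, lshift m' s.2).
apply: (prod_le_injective (h := h) (f := fun p => ph (bil (-1) (w p.1) (w p.2)))) => //.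
  by move=> [a b] [c d] [e1 e2]; congr pair; apply: val_inj => //=; apply: (addnI e1).
by move=> [a b]; rewrite unfold_in /below_diag /= (leq_trans (ltn_ord b)) ?leq_addr.
Qed.

Lemma prod_with_sites (f : F * F -> F * F -> R) (g : F * F -> R) :
  \prod_(k < m') (g (w (rshift m k)) *
    \prod_(j < m) f (w (rshift m k)) ([ffun j => w (lshift m' j)] j)) =
  \prod_(s : 'I_m' + 'I_m' * 'I_m)
    match s with
    | inl k => g (w (rshift m k))
    | inr p => f (w (rshift m p.1)) (w (lshift m' p.2))
    end.
Proof.
rewrite big_sumType big_split /=; congr (_ * _).
rewrite -(pair_bigA _ (fun k j => f (w (rshift m k)) (w (lshift m' j)))) /=.
by apply: eq_bigr => k _; apply: eq_bigr => j _; rewrite ffunE.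
Qed.

(** Keeping the diagonal entries of the second half makes [gam] nonzero. Without them every line,
    not only the two axes, could carry constant phases, and the total would be larger by a factor
    [q]. *)
Lemma prod_sym_le :
  \prod_(p in on_or_below_diag (m + m'))
    ph (if p.1 == p.2 then quad (w p.1) else bil 1 (w p.1) (w p.2)) <=
  \prod_(k < m') (site ph 1 (w (rshift m k)) *
    \prod_(j < m) ph (pairing 1 0 (w (rshift m k)) ([ffun j => w (lshift m' j)] j))).
Proof.
rewrite (prod_with_sites (fun v y => ph (pairing 1 0 v y))).
pose h (s : 'I_m' + 'I_m' * 'I_m) : 'I_(m + m') * 'I_(m + m') :=
  match s with inl k => (rshift m k, rshift m k)
             | inr p => (rshift m p.1, lshift m' p.2) end.
have lr (a : 'I_m') (b : 'I_m) : (lshift m' b < rshift m a)%N.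
  by rewrite /= (leq_trans (ltn_ord b)) ?leq_addr.
apply: le_trans (prod_le_injective (h := h) (f := fun p => ph (if p.1 == p.2 then
  quad (w p.1) else bil 1 (w p.1) (w p.2))) _ _ _) _ => //.
- move=> [a|[a b]] [c|[c d]] [].
  + by move=> e _; congr (inl _); apply: val_inj; apply: (addnI e).
  + by move=> -> e; have := lr c d; rewrite /= e ltnn.
  + by move=> <- e; have := lr a b; rewrite /= e ltnn.
  + move=> e1 e2; congr (inr _); congr pair; apply: val_inj => //=.
    by apply: (addnI e1).
- move=> [a|[a b]]; rewrite unfold_in /on_or_below_diag /=; first exact: leqnn.
  exact: ltnW (lr a b).
rewrite le_eqVlt; apply/orP; left; apply/eqP; apply: eq_bigr => -[a|[a b]] _ /=.
  by rewrite eqxx /site mul1r.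
have := lr a b; rewrite ltn_neqAle eq_sym val_eqE => /andP[/negPf -> _].
by rewrite /pairing !mul0r !addr0.
Qed.

(** The site factors come from the edges joining the second half to the removed vertex [ord_max]. *)
Lemma prod_laplacian_le :
  \prod_(p in above_diag (m + m').+1)
    ph (pairing 1 (-1) (extend0 w p.1) (extend0 w p.2)) <=
  \prod_(k < m') (site ph (-1) (w (rshift m k)) *
    \prod_(j < m) ph (pairing 1 (-1) (w (rshift m k)) ([ffun j => w (lshift m' j)] j))).
Proof.
rewrite (prod_with_sites (fun v y => ph (pairing 1 (-1) v y))).
pose W := widen_ord (leqnSn (m + m')).
pose h (s : 'I_m' + 'I_m' * 'I_m) : 'I_(m + m').+1 * 'I_(m + m').+1 :=
  match s with inl k => (W (rshift m k), ord_max)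
             | inr p => (W (lshift m' p.2), W (rshift m p.1)) end.
have lr (a : 'I_m') (b : 'I_m) : (lshift m' b < rshift m a)%N.
  by rewrite /= (leq_trans (ltn_ord b)) ?leq_addr.
have lW k : (W k < m + m')%N by exact: (ltn_ord k).
apply: le_trans (prod_le_injective (h := h)
  (f := fun p => ph (pairing 1 (-1) (extend0 w p.1) (extend0 w p.2))) _ _ _) _ => //.
- move=> [a|[a b]] [c|[c d]] [].
  + by move=> e; congr (inl _); apply: val_inj; apply: (addnI e).
  + by move=> _ e; have := lW (rshift m c); rewrite /= -e ltnn.
  + by move=> _ e; have := lW (rshift m a); rewrite /= e ltnn.
  + move=> e1 e2; congr (inr _); congr pair; apply: val_inj => //=.
    by apply: (addnI e2).
- move=> [a|[a b]]; rewrite unfold_in /above_diag /=; first exact: (lW (rshift m a)).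
  exact: (lr a b).
rewrite le_eqVlt; apply/orP; left; apply/eqP; apply: eq_bigr => -[a|[a b]] _ /=.
  rewrite extend0_widen extend0_max /site; congr ph.
  by rewrite /pairing bil0r /quad /=; ring.
by rewrite !extend0_widen; congr ph; rewrite /pairing /bil; ring.
Qed.

End Products.
End Matrices.

(** * Choice of the scales *)

(* The scales of the argument: [s] cuts off the fiber sums, [k] is the number of
   doublings, [r] the size of the samples and [e] the number of exceptions. *)
Record scales (R : realType) (alpha : R) (q m m' : nat) (s : R) (k r e : nat) :
    Prop := Scales {
  sc_s_ge0 : 0 <= s;
  sc_r_gt0 : (0 < r)%N;
  sc_e_lt_m : (e < m)%N;
  sc_m_le : (m <= m')%N;
  sc_m'_le : (m' <= m.+1)%N;
  sc_m'_le_q : (m' <= q)%N;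
  sc_tail_le : q%:R ^+ 2 * expR (- (s / 2)) <= q%:R^-1;
  sc_sample_large : q%:R ^+ 2 < expR (alpha / 8 * r%:R);
  sc_growth_large : 8 <= (alpha / 2) ^+ 2 * (3 / 2) ^+ k;
  sc_exceptions_le : 4 ^+ k.+1 * s <= e%:R * (alpha / 16);
  sc_q_large : q%:R^-1 <= alpha / 16;
  sc_few_exceptions :
    (q ^ (3 * r + 2 * e + 5) * m.+1 ^ e)%:R * (1 - alpha / 16) ^+ m' <= 1 }.

Lemma bernoulli_3half (R : realFieldType) k : 1 + k%:R / 2 <= (3 / 2) ^+ k :> R.
Proof.
elim: k => [|k IH]; first by rewrite mul0r addr0 expr0.
rewrite exprS -natr1; have : 0 <= k%:R :> R by [].
by move: IH; lra.
Qed.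

Lemma nat_between (R : realType) (x : R) : 0 <= x -> exists n : nat, x <= n%:R <= x + 1.
Proof.
move=> x0; have /andP[h1 h2] := truncn_itv x0; exists (Num.truncn x).+1.
by rewrite (ltW h2) /= -natr1 lerD2r.
Qed.

Lemma half_bounds n : [/\ (n <= (n - n./2) * 2)%N, (n <= n./2 * 2 + 1)%N,
  (n./2 <= n - n./2)%N & (n - n./2 <= n./2.+1)%N].
Proof. by split; lia. Qed.

Lemma half_lt_half n : (2 <= n -> n./2.+1 <= n)%N.
Proof. by lia. Qed.

Lemma exists_scales (R : realType) (alpha : R) : 0 < alpha -> alpha <= 1 ->
  exists C : R, forall n q : nat, 16 / alpha <= q%:R -> (n <= q)%N ->
    C * ln q%:R ^+ 2 <= n%:R ->
    exists s k r e, scales alpha q n./2 (n - n./2) s k r e.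
Proof.
move=> a0 a1.
(* By Bernoulli [(3 / 2) ^ k] exceeds [k / 2], so [k] of size [64 / alpha ^ 2] suffices. *)
have [k hk] : exists k : nat, 8 <= (alpha / 2) ^+ 2 * (3 / 2) ^+ k.
  have [k /andP[hk _]] := @nat_between R (64 / alpha ^+ 2) (divr_ge0 (ler0n _ _) (sqr_ge0 _)).
  exists k; have := bernoulli_3half R k; have a20 : 0 < alpha ^+ 2 by rewrite exprn_gt0.
  rewrite ler_pdivrMr // in hk; move=> h.
  have : alpha ^+ 2 * (1 + k%:R / 2) <= alpha ^+ 2 * (3 / 2) ^+ k by rewrite ler_pM2l.
  by rewrite expr_div_n; lra.
(* With [L = ln q], the choice [s = 6 * L] makes the tail [q^-1], and [e] must reach
   [16 / alpha * 4 ^ k.+1 * s = C1 * L]. [C2 * L] bounds [3 * r + 3 * e + 5], the third [e] coming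
   from [m.+1 ^ e <= q ^ e]. The final constant ensures [C2 * L ^ 2 <= alpha / 16 * (n / 2)]. *)
pose C1 : R := 96 * 4 ^+ k.+1 / alpha.
have C1_ge0 : 0 <= C1 by rewrite divr_ge0 ?mulr_ge0 ?exprn_ge0 // ltW.
pose C2 : R := 48 / alpha + 3 * C1 + 14.
exists (32 / alpha * C2) => n q qa nq Cn.
have ia : 1 <= alpha^-1 by rewrite invf_ge1.
have q16 : 16 <= q%:R :> R by apply: le_trans qa; rewrite ler_peMr.
have q0 : 0 < q%:R :> R by apply: lt_le_trans q16.
set L := ln (q%:R : R) in Cn *.
have qE : q%:R = expR L by rewrite lnK // posrE.
have L1 : 1 <= L.
  rewrite -ler_expR -qE; apply: le_trans q16.
  have := expR_ge1Dx (- (1 / 2) : R); have e0 := expR_gt0 (1 / 2 : R).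
  rewrite expRN => h.
  have h2 : expR (1 / 2 : R) <= 2.
    rewrite -[leLHS]invrK invf_ple ?posrE ?invr_gt0 //.
    by apply: le_trans h; lra.
  have -> : (1 : R) = 1 / 2 + 1 / 2 by lra.
  by rewrite expRD; apply: (@le_trans _ _ (2 * 2)); [rewrite ler_pM // ltW|lra].
have [e /andP[e1 e2]] := @nat_between R (C1 * L) (mulr_ge0 C1_ge0 (le_trans ler01 L1)).
have [r /andP[r1 r2]] : exists r : nat, 16 / alpha * L + 1 <= r%:R <= 16 / alpha * L + 1 + 1.
  apply: nat_between; rewrite addr_ge0 // mulr_ge0 // ?divr_ge0 // ?ltW //.
  exact: lt_le_trans L1.
have LL : L <= L ^+ 2 by rewrite expr2 ler_peMl // (le_trans ler01).
have [hn1 hn2 hn3 hn4] := half_bounds n.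
have n_half : n%:R / 2 <= (n - n./2)%N%:R :> R.
  by rewrite ler_pdivrMr // -natrM ler_nat.
have n_half' : n%:R - 1 <= (n./2)%:R * 2 :> R.
  by rewrite lerBlDr -natrM natr1 ler_nat -addn1.
have C2L : (3 * r + 3 * e + 5)%:R <= C2 * L.
  have -> : C2 * L = 3 * (16 / alpha * L) + 3 * (C1 * L) + 14 * L by rewrite /C2; ring.
  rewrite natrD natrD natrM natrM; move: r2 e2 L1.
  by move: (16 / alpha * L) (C1 * L) => X Y; lra.
have C2_ge : C1 + 14 <= C2.
  rewrite /C2; have : 0 <= 48 / alpha by rewrite divr_ge0 // ltW.
  by lra.
have nC2 : 32 * (C2 * L ^+ 2) <= n%:R.
  apply: le_trans Cn.
  have -> : 32 / alpha * C2 * L ^+ 2 = alpha^-1 * (32 * (C2 * L ^+ 2)) by ring.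
  have C2_ge0 : 0 <= C2 by apply: le_trans C2_ge; rewrite addr_ge0.
  by rewrite ler_peMl // mulr_ge0 // mulr_ge0 ?sqr_ge0.
have n_ge : 32 * (C1 + 14) * L <= n%:R.
  apply: le_trans nC2; rewrite -mulrA ler_wpM2l // ler_pM //; first lra.
  exact: le_trans L1.
have n2 : (2 <= n)%N.
  rewrite -(ler_nat R); apply: le_trans n_ge; nra.
have em : (e < n./2)%N.
  rewrite -(ltr_nat R); nra.
exists (6 * L), k, r, e; split => //.
- by lra.
- rewrite -(ltr_nat R); apply: lt_le_trans r1.
  by rewrite ltr_wpDl // mulr_ge0 ?divr_ge0 ?ltW // (lt_le_trans ltr01).
- exact: leq_trans (leq_subr _ _) nq.
- rewrite qE -expRN -expRM_natl -expRD ler_expR; lra.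
- rewrite qE -expRM_natl ltr_expR.
  have h : alpha / 8 * (16 / alpha * L + 1) <= alpha / 8 * r%:R.
    by rewrite ler_wpM2l // divr_ge0 // ltW.
  apply: lt_le_trans h; rewrite mulrDr.
  have -> : alpha / 8 * (16 / alpha * L) = 2 * L by field; rewrite gt_eqF.
  by lra.
- apply: (@le_trans _ _ (C1 * L * (alpha / 16))); last by rewrite ler_wpM2r // divr_ge0 // ltW.
  by rewrite le_eqVlt /C1; apply/orP; left; apply/eqP; field; rewrite gt_eqF.
- by rewrite invf_ple ?posrE ?divr_gt0 // invf_div.
- apply: (@le_trans _ _ (q%:R ^+ (3 * r + 3 * e + 5) * expR (- (alpha / 16)) ^+ (n - n./2))).
    apply: ler_pM; rewrite ?exprn_ge0 //.
    + by lra.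
    + rewrite -natrX ler_nat.
      have -> : (3 * r + 3 * e + 5 = (3 * r + 2 * e + 5) + e)%N.
        by rewrite (mulnDl 2 1 e) mul1n !addnA addnAC.
      rewrite (expnD q (3 * r + 2 * e + 5) e) leq_mul //; have [->|e0] := posnP e; first by rewrite !expn0.
      by rewrite leq_exp2r // (leq_trans _ nq) // half_lt_half.
    + by rewrite lerXn2r ?nnegrE ?expR_ge0 ?expR_ge1Dx //; lra.
  rewrite qE -!expRM_natl -expRD -[leRHS]expR0 ler_expR.
  have h1 : (3 * r + 3 * e + 5)%:R * L <= C2 * L ^+ 2.
    by rewrite expr2 mulrA ler_wpM2r // (le_trans ler01).
  have h2 : alpha / 32 * n%:R <= (n - n./2)%N%:R * (alpha / 16).
    have : n%:R / 2 * (alpha / 16) <= (n - n./2)%N%:R * (alpha / 16).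
      by rewrite ler_wpM2r // divr_ge0 // ltW.
    by lra.
  have h3 : C2 * L ^+ 2 <= alpha / 32 * n%:R.
    have : alpha / 32 * (32 / alpha * C2 * L ^+ 2) <= alpha / 32 * n%:R.
      by rewrite ler_wpM2l // divr_ge0 // ltW.
    have -> : alpha / 32 * (32 / alpha * C2 * L ^+ 2) = C2 * L ^+ 2 by field; rewrite gt_eqF.
    by [].
  rewrite mulrN subr_le0. exact: le_trans h1 (le_trans h3 h2).
Qed.

(** * Singularity modulo a prime *)

Section SingularProbability.
Variables (R : realType) (F : finFieldType) (co si : F -> R).
Hypothesis chi : additive_character co si.
Variables (mu : F -> R) (alpha : R).
Hypotheses (alpha_gt0 : 0 < alpha) (alpha_le1 : alpha <= 1).
Hypotheses (mu_ge0 : forall r, 0 <= mu r) (sum_mu : \sum_r mu r = 1).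
Hypothesis mu_le : forall r, mu r <= 1 - alpha.
Hypothesis two_neq0 : 2 != 0 :> F.
Hypothesis F_nat : forall t : F, exists k : nat, t = k%:R.
Variables (m m' : nat) (s : R) (k r e : nat).
Hypothesis sc : scales alpha #|F| m m' s k r e.

Local Notation q := (#|F|).
Local Notation ph := (char_norm co si mu).
Local Notation n := (m + m')%N.

Let prof : decay_profile alpha ph (char_cost co mu).
Proof. exact: char_decay_profile. Qed.

Let q_gt0 : 0 < q%:R :> R.
Proof. by rewrite ltr0n; apply/card_gt0P; exists 0. Qed.

Lemma law_prob_ge0 (K : finType) (D : {pred K}) x : 0 <= law_prob mu D x.
Proof. exact: prodr_ge0. Qed.

(** Markov's inequality for the number of kernel vectors, at least [q ^ d] for a singular matrix. *)
Lemma singular_prob_le (K : finType) (D : {pred K}) (M : {ffun K -> F} -> 'M[F]_n)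
    (L : K -> {ffun 'I_n -> F * F} -> F) (d : nat) (sg kap gam : F) (B : R) :
  (forall x (w : {ffun 'I_n -> F * F}),
     \sum_i (w i).1 * (\sum_j M x i j * (w j).2) = \sum_(k in D) x k * L k w) ->
  (forall x, \det (M x) = 0 -> (q ^ d <= #|[set v : 'cV[F]_n | M x *m v == 0%R]|)%N) ->
  (forall w : {ffun 'I_n -> F * F}, \prod_(p in D) ph (L p w) <=
     \prod_(k < m') (site ph gam (w (rshift m k)) *
       \prod_(j < m) ph (pairing sg kap (w (rshift m k)) ([ffun j => w (lshift m' j)] j)))) ->
  \sum_(a : {ffun 'I_m -> F * F}) fiber_sum ph sg kap gam a ^+ m' <= B * q%:R ^+ (n + d) ->
  q%:R ^+ d * \sum_(x in pfamily 0 D (fun=> predT) | \det (M x) == 0) law_prob mu D x <=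
    B * q%:R ^+ d.
Proof.
move=> ML ker pr tot.
have qn : 0 < q%:R ^+ n :> R by rewrite exprn_gt0.
rewrite -(ler_pM2l qn); apply: (@le_trans _ _ (B * q%:R ^+ (n + d))); last first.
  by rewrite exprD mulrCA.
apply: le_trans tot; rewrite -(sum_split_ffun m' (fun (a : {ffun 'I_m -> F * F}) v => site ph gam v *
  \prod_(j < m) ph (pairing sg kap v (a j)))).
apply: le_trans (ler_sum _ (fun w _ => pr w)).
apply: le_trans (expected_kernel chi mu ML).
rewrite ler_pM2l // mulr_sumr.
rewrite [leRHS](bigID (fun x => \det (M x) == 0)) /= -[leLHS]addr0 lerD //; last first.
  by apply: sumr_ge0 => x _; rewrite mulr_ge0 ?law_prob_ge0.
apply: ler_sum => x /andP[_ /eqP/ker h].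
by rewrite mulrC ler_wpM2l ?law_prob_ge0 // -natrX ler_nat.
Qed.

Lemma singular_prob_skew : ~~ odd n ->
  \sum_(x in pfamily 0 (below_diag n) (fun=> predT) | \det (skew_matrix x) == 0)
    law_prob mu (below_diag n) x <= (3 + 3 * expR 1) / q%:R.
Proof.
move=> en; have q2 : 0 < q%:R ^+ 2 :> R by rewrite exprn_gt0.
rewrite -(ler_pM2l q2).
have -> : q%:R ^+ 2 * ((3 + 3 * expR 1) / q%:R) = (3 + 3 * expR 1) / q%:R * q%:R ^+ 2 :> R.
  by rewrite mulrC.
have N1 : - 1 != 0 :> F by rewrite oppr_eq0 oner_eq0.
apply: (@singular_prob_le _ _ _ _ 2 (-1) 0 0 _ (skew_matrix_form (n := n))).
- move=> x; apply: card_kernel_singular_skew => //.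
  apply/matrixP => i j; rewrite !mxE.
  by case: ltngtP; rewrite ?opprK ?oppr0.
- exact: (prod_skew_le prof).
have -> : (3 + 3 * expR 1) / q%:R * q%:R ^+ (n + 2) = (3 + 3 * expR 1) * q%:R ^+ n.+1 :> R.
  by rewrite addn2 [in LHS]exprS mulrA divfK // gt_eqF.
by apply: (total_le_alternating alpha_gt0 alpha_le1 prof two_neq0 F_nat 0 N1
  (sc_s_ge0 sc) (sc_r_gt0 sc) (sc_e_lt_m sc) (sc_m_le sc) (sc_m'_le sc) (sc_m'_le_q sc)
  (sc_tail_le sc) (sc_sample_large sc) (sc_growth_large sc) (sc_exceptions_le sc)
  (sc_q_large sc) (sc_few_exceptions sc)).
Qed.

Lemma total_le_unit_site (kap gam : F) : gam != 0 ->
  \sum_(a : {ffun 'I_m -> F * F}) fiber_sum ph 1 kap gam a ^+ m' <=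
    (2 + 3 * expR 1) / q%:R * q%:R ^+ (n + 1).
Proof.
move=> gam0.
have -> : (2 + 3 * expR 1) / q%:R * q%:R ^+ (n + 1) = (2 + 3 * expR 1) * q%:R ^+ n :> R.
  by rewrite addn1 exprS mulrA divfK // gt_eqF.
by apply: (total_le_site alpha_gt0 alpha_le1 prof two_neq0 F_nat kap (oner_neq0 F)
  (sc_s_ge0 sc) (sc_r_gt0 sc) (sc_e_lt_m sc) (sc_m_le sc) (sc_m'_le sc) (sc_m'_le_q sc)
  (sc_tail_le sc) (sc_sample_large sc) (sc_growth_large sc) (sc_exceptions_le sc)
  (sc_q_large sc) (sc_few_exceptions sc)).
Qed.

Lemma singular_prob_sym :
  \sum_(x in pfamily 0 (on_or_below_diag n) (fun=> predT) | \det (sym_matrix x) == 0)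
    law_prob mu (on_or_below_diag n) x <= (2 + 3 * expR 1) / q%:R.
Proof.
rewrite -(ler_pM2l q_gt0) [leRHS]mulrC -[q%:R]expr1.
apply: (@singular_prob_le _ _ _ _ 1 1 0 1 _ (sym_matrix_form (n := n))).
- by move=> x; rewrite expn1; apply: card_kernel_singular.
- exact: (prod_sym_le prof).
by rewrite expr1; apply: total_le_unit_site; apply: oner_neq0.
Qed.

Lemma singular_prob_laplacian :
  \sum_(x in pfamily 0 (above_diag n.+1) (fun=> predT) | \det (laplacian_matrix x) == 0)
    law_prob mu (above_diag n.+1) x <= (2 + 3 * expR 1) / q%:R.
Proof.
rewrite -(ler_pM2l q_gt0) [leRHS]mulrC -[q%:R]expr1.
apply: (@singular_prob_le _ _ _ _ 1 1 (-1) (-1) _ (laplacian_matrix_form (n := n))).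
- by move=> x; rewrite expn1; apply: card_kernel_singular.
- exact: (prod_laplacian_le prof).
by rewrite expr1; apply: total_le_unit_site; rewrite oppr_eq0 oner_eq0.
Qed.

End SingularProbability.

(** * Primes in a prescribed range *)

Lemma central_binomial_ge k : (2 ^ k <= 'C(2 * k, k))%N.
Proof.
elim: k => // k IH; rewrite expnS; apply: leq_trans (leq_mul (leqnn 2) IH) _.
have -> : (2 * k.+1 = (2 * k).+2)%N by lia.
rewrite binS mul2n -addnn; apply: leq_add; first by rewrite binS leq_addl.
by case: (k) => [|j]; rewrite ?bin0 // binS leq_addr.
Qed.

(** Legendre's formula gives the exponent as the sum of [(2 * k) %/ p ^ i - 2 * (k %/ p ^ i)]; each
    term is 0 or 1 and vanishes once [p ^ i > 2 * k]. *)
Lemma pfactor_central_binomial p k : prime p -> (0 < k)%N ->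
  (p ^ logn p 'C(2 * k, k) <= 2 * k)%N.
Proof.
move=> pp k0; have p1 := prime_gt1 pp.
have C0 : (0 < 'C(2 * k, k))%N by rewrite bin_gt0; lia.
set t := trunc_log p (2 * k).
have k2 : (0 < 2 * k)%N by rewrite muln_gt0.
apply: (@leq_trans (p ^ t)); last by rewrite trunc_logP.
rewrite leq_exp2l //.
have := congr1 (logn p) (bin_fact (_ : k <= 2 * k)%N); rewrite mulnC leq_pmulr // => /(_ isT).
have -> : (k * 2 - k = k)%N by lia.
rewrite lognM ?muln_gt0 ?fact_gt0 // ?[(k * 2)%N]mulnC // lognM ?fact_gt0 //.
rewrite !logn_fact // => E.
have ext : (\sum_(1 <= i < k.+1) k %/ p ^ i = \sum_(1 <= i < (2 * k).+1) k %/ p ^ i)%N.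
  rewrite [RHS](big_cat_nat _ _ (n := k.+1)) //=; last by lia.
  rewrite -[LHS]addn0; congr (_ + _)%N.
  rewrite big_nat_cond big1 // => i /andP[/andP[ki _] _].
  by rewrite divn_small // (leq_trans ki) // ltnW // ltn_expl.
rewrite ext -big_split /= in E.
have : (\sum_(1 <= i < (2 * k).+1) (2 * k) %/ p ^ i <=
   \sum_(1 <= i < (2 * k).+1) ((i <= t) + (k %/ p ^ i + k %/ p ^ i)))%N.
  apply: leq_sum => i _; have [it|it] := leqP i t.
    have pi0 : (0 < p ^ i)%N by rewrite expn_gt0 ltnW.
    by move: (p ^ i)%N pi0 => d d0; nia.
  rewrite divn_small //; apply: leq_trans (trunc_log_ltn _ p1) _.
  by rewrite leq_exp2l.
rewrite -E [leqRHS]big_split /= leq_add2r => h; apply: leq_trans h _.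
have : (\sum_(1 <= i < (2 * k).+1) (i <= t) = minn (2 * k) t)%N.
  elim: (2 * k)%N => [|j IH]; first by rewrite big_geq // min0n.
  by rewrite big_nat_recr //= IH; lia.
by move=> ->; apply: geq_minr.
Qed.

(* If all the prime factors of [binomial (2 N^2) (N^2)] were at most [N], it
   would be at most [(2 N^2)^N], less than [2^(N^2)]. *)
Lemma exists_prime_between N : (7 <= N)%N ->
  exists p, [/\ prime p, (N < p)%N & (p <= 2 * N ^ 2)%N].
Proof.
move=> N7; set k := (N ^ 2)%N; have k0 : (0 < k)%N by rewrite expn_gt0; case: (N) N7.
have [/hasP[p]|/hasPn no] := boolP (has (fun p => prime p && (N < p)%N) (iota 0 (2 * k).+1)).
  by rewrite mem_iota add0n ltnS => /andP[_ pk] /andP[pp Np]; exists p.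
exfalso.
have le2 : (2 ^ k <= (2 * k) ^ N)%N.
  apply: leq_trans (central_binomial_ge k) _.
  have C0 : (0 < 'C(2 * k, k))%N by rewrite bin_gt0; lia.
  have Ck : (forall p, p \in primes 'C(2 * k, k) -> p < N.+1)%N.
    move=> p; rewrite mem_primes => /and3P[pp _ pd]; rewrite ltnNge; apply/negP => Np.
    have := no p; rewrite mem_iota add0n ltnS pp Np /=.
    have : (p ^ 1 <= 2 * k)%N.
      apply: leq_trans (pfactor_central_binomial pp k0).
      by rewrite leq_exp2l ?prime_gt1 // -pfactor_dvdn // expn1.
    by rewrite expn1 => -> /(_ isT).
  rewrite {1}(prod_prime_decomp C0) prime_decompE big_map /=.
  apply: (@leq_trans ((2 * k) ^ size (primes 'C(2 * k, k)))).
    have key p : p \in primes 'C(2 * k, k) -> (p ^ logn p 'C(2 * k, k) <= 2 * k)%N.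
      by rewrite mem_primes => /and3P[pp _ _]; apply: pfactor_central_binomial.
    elim: (primes _) key => [|p l IH] key; first by rewrite big_nil.
    rewrite big_cons /= expnS leq_mul //; first by apply: key; rewrite inE eqxx.
    by apply: IH => p' p'l; apply: key; rewrite inE p'l orbT.
  apply: leq_pexp2l; first by rewrite muln_gt0 k0.
  have -> : N = size (iota 1 N) by rewrite size_iota.
  apply: uniq_leq_size; first exact: primes_uniq.
  by move=> p hp; rewrite mem_iota add1n Ck // andbT; move: hp; rewrite mem_primes => /andP[/prime_gt0].
(* The [N]-th root of [le2], as [k = N ^ 2]. It fails from [N = 7] on, where [128 > 98]. *)
have h2 : (2 ^ N <= 2 * N ^ 2)%N.
  by rewrite -(leq_exp2r _ _ (_ : 0 < N)%N) -?expnM ?mulnn //; case: (N) N7.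
move: h2; apply/negP; rewrite -ltnNge; move: N7; clear.
elim: N => // N IH; rewrite leq_eqVlt => /orP[/eqP <- //|N7].
have {}IH := IH N7; apply: (@leq_trans (2 * (2 * N ^ 2).+1)).
  by rewrite -!mulnn; nia.
by rewrite (expnS 2 N) leq_mul2l.
Qed.

(** * From events to residues *)

(** The prime lies between [expR y] and [expR (3 * y)], so [C * ln p ^ 2] is at most
    [9 * |C| * y ^ 2], which is below [n = y ^ 4] for large [y]. *)
Lemma exists_prime_scales (R : realType) (alpha : R) : 0 < alpha -> alpha <= 1 ->
  exists Y : R, forall (n : nat) (y : R), 0 <= y -> y ^+ 4 = n%:R -> Y <= y ->
    exists p : nat, [/\ prime p, 2 != 0 :> 'F_p, expR y <= p%:R &
      exists s k r e, scales alpha #|'F_p| n./2 (n - n./2) s k r e].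
Proof.
move=> a0 a1; have [C HC] := exists_scales a0 a1.
have B0 : 0 <= 16 / alpha by rewrite divr_ge0 // ltW.
(* The [64] yields [n <= p] through [y ^ 4 <= (y / 8) ^ 8], [9 * |C|] yields the bound on
   [ln p ^ 2], and [16 / alpha] the lower bound on [p]. *)
exists (64 + 9 * `|C| + 16 / alpha) => n y y0 yn Yy.
have C0 : 0 <= `|C| by [].
have y64 : 64 <= y by lra.
have ey : 1 + y <= expR y by apply: expR_ge1Dx.
pose N := Num.truncn (expR y).
have /andP[N1 N2] : N%:R <= expR y < N.+1%:R by apply: truncn_itv; apply: expR_ge0.
have N7 : (7 <= N)%N.
  rewrite -ltnS -(ltr_nat R); apply: le_lt_trans N2; lra.
have [p [pp Np pN]] := exists_prime_between N7.
have yp : expR y <= p%:R.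
  by apply: le_trans (ltW N2) _; rewrite ler_nat.
have ap : 16 / alpha <= p%:R by apply: le_trans yp; lra.
have p2 : (2 < p)%N by apply: leq_trans (leq_trans N7 (ltnW Np)).
have p0 : 0 < p%:R :> R by rewrite ltr0n prime_gt0.
exists p; split => //.
  by rewrite -(dvdn_pcharf (pchar_Fp pp)) gtnNdvd.
rewrite card_Fp //; apply: HC => //.
  rewrite -(ler_nat R) -yn; apply: le_trans yp.
  have h8 : 1 + y / 8 <= expR (y / 8) by apply: expR_ge1Dx.
  have -> : y = 8%:R * (y / 8) by field.
  rewrite expRM_natl; apply: (@le_trans _ _ ((y / 8) ^+ 8)).
    have -> : (8 * (y / 8)) ^+ 4 = y ^+ 4 :> R by congr (_ ^+ _); field.
    have -> : (y / 8) ^+ 8 = y ^+ 4 * ((y / 64) ^+ 4) by field.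
    by rewrite ler_peMr ?exprn_ge0 // exprn_ege1 // ler_pdivlMr // mul1r.
  by rewrite lerXn2r ?nnegrE ?expR_ge0 ?divr_ge0 //; lra.
have lnp : ln (p%:R : R) <= 3 * y.
  rewrite -ler_expR lnK ?posrE //; apply: (@le_trans _ _ (2 * N ^ 2)%:R).
    by rewrite ler_nat.
  rewrite natrM natrX; have -> : 3 * y = y + 2%:R * y by lra.
  rewrite expRD expRM_natl; apply: ler_pM => //.
    by lra.
  by rewrite lerXn2r ?nnegrE ?expR_ge0.
have ln0 : 0 <= ln (p%:R : R) by apply: ln_ge0; rewrite ler1n prime_gt0.
apply: (@le_trans _ _ (`|C| * (3 * y) ^+ 2)).
  apply: (@le_trans _ _ (`|C| * ln p%:R ^+ 2)).
    by rewrite ler_wpM2r ?exprn_ge0 // ler_norm.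
  by rewrite ler_wpM2l // lerXn2r ?nnegrE // mulr_ge0.
rewrite -yn; have -> : `|C| * (3 * y) ^+ 2 = 9 * `|C| * y ^+ 2 by ring.
have -> : y ^+ 4 = y ^+ 2 * y ^+ 2 by ring.
rewrite ler_wpM2r ?exprn_ge0 //; apply: (@le_trans _ _ y); first lra.
by rewrite expr2 ler_peMr //; lra.
Qed.

Local Open Scope classical_set_scope.

Section Reduction.
Variables (d : measure_display) (T : measurableType d) (R : realType).
Variable P : probability T R.

(** The event is a union, over the countably many value vectors satisfying [G], of finite
    intersections of measurable sets. *)
Lemma measurable_countable_event (K : finType) (C : countType) (f : K -> T -> C)
    (G : (K -> C) -> Prop) :
  (forall k c, measurable (f k @^-1` [set c])) -> measurable [set w | G (f^~ w)].
Proof.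
move=> fm; pose A (x : {ffun K -> C}) : set T :=
  [set w | G x /\ forall k, f k w = x k].
have -> : [set w | G (f^~ w)] = \bigcup_x A x.
  apply/seteqP; split => [w Gw|w [x _ [Gx fx]]] /=.
    have e : [ffun k => f k w] = f^~ w :> (K -> C) by apply/funext => k; rewrite ffunE.
    by exists [ffun k => f k w] => //; split => [|k]; rewrite ?e ?ffunE.
  by have -> : f^~ w = x by apply/funext.
apply: countable_bigcupT_measurable => [|x]; first exact: countableP.
have [Gx|nGx] := pselect (G x); last first.
  by rewrite (_ : A x = set0) //; apply/seteqP; split => // w [].
have -> : A x = \bigcap_(k in [set: K]) (f k @^-1` [set x k]).
  apply/seteqP; split => [w [_ h] k _|w h] /=; first exact: h.
  by split => // k; apply: h.
by apply: fin_bigcap_measurable => // k _; apply: fm.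
Qed.

Lemma probability_bigsetU_le (I : finType) (Q : pred I) (A : I -> set T) :
  (forall i, measurable (A i)) ->
  (P (\big[setU/set0]_(i | Q i) A i) <= \sum_(i | Q i) P (A i))%E.
Proof.
move=> mA; suff : measurable (\big[setU/set0]_(i | Q i) A i) /\
  (P (\big[setU/set0]_(i | Q i) A i) <= \sum_(i | Q i) P (A i))%E by case.
elim/big_ind2: _ => [|B x B' x' [mB h] [mB' h']|i _].
- by rewrite measure0.
- split; first exact: measurableU.
  exact: le_trans (measureU2 P mB mB') (leeD h h').
- by split.
Qed.

Variables (d' : measure_display) (T' : measurableType d').
Hypothesis discrete : forall B : set T', measurable B.
Variables (F : finFieldType) (red : T' -> F) (mu : F -> R).

(** The event is covered by the cylinders that fix the residues on [D], whose probabilities factor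
    by independence. Coordinates outside [D], whose law is unknown, are normalised to [0]. *)
Lemma event_le_law_prob (K : finType) (D : {pred K}) (X : K -> {RV P >-> T'})
    (E : set T) (G : pred {ffun K -> F}) :
  mutually_independent P D X ->
  (forall k r, k \in D -> P (X k @^-1` (red @^-1` [set r])) = (mu r)%:E) ->
  measurable E ->
  (forall w, E w -> G [ffun k => if k \in D then red (X k w) else 0]) ->
  (P E <= (\sum_(x in pfamily 0 D (fun=> predT) | G x) law_prob mu D x)%:E)%E.
Proof.
move=> ind law mE EG.
pose A (x : {ffun K -> F}) : set T :=
  \bigcap_(k in [set` [set k in D]]) (X k @^-1` (red @^-1` [set x k])).
have mA x : measurable (A x).
  by apply: fin_bigcap_measurable => [|k _]; [exact: finite_finset|apply: measurable_funPTI].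
have PA x : P (A x) = (law_prob mu D x)%:E.
  rewrite /A ind //; first last.
    by apply/fintype.subsetP => k; rewrite inE.
  rewrite /law_prob -prodEFin; apply: eq_big => k; first by rewrite inE.
  by rewrite inE => kD; apply: law.
apply: (@le_trans _ _ (P (\big[setU/set0]_(x in pfamily 0 D (fun=> predT) | G x) A x))).
  apply: le_measure; rewrite ?inE //; first exact: bigsetU_measurable.
  move=> w Ew; have Gw := EG _ Ew; rewrite -bigcup_seq_cond.
  exists [ffun k => if k \in D then red (X k w) else 0].
    rewrite /= mem_index_enum /= Gw andbT; apply/pfamilyP; split => //.
    by apply/supportP => k kD; rewrite ffunE (negPf kD).
  by move=> k /=; rewrite inE ffunE => ->.
apply: le_trans (probability_bigsetU_le _ mA) _.
by rewrite (eq_bigr _ (fun x _ => PA x)) sumEFin.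
Qed.

Lemma sum_law (X : {RV P >-> T'}) :
  (forall r, P (X @^-1` (red @^-1` [set r])) = (mu r)%:E) -> \sum_r mu r = 1.
Proof.
move=> law; have mX (B : set T') : measurable (X @^-1` B) by apply: measurable_funPTI.
have key (s : seq F) : uniq s ->
    P (X @^-1` (red @^-1` [set r | r \in s])) = (\sum_(r <- s) mu r)%:E.
  elim: s => [|r s IH] /=.
    move=> _; rewrite big_nil (_ : _ @^-1` _ = set0) ?measure0 //.
    by apply/seteqP; split.
  move=> /andP[rs us]; rewrite big_cons EFinD -IH // -law -measureU //.
    congr (P _); apply/seteqP; split => w /=; rewrite inE.
      by move=> /orP[/eqP|]; [left|right].
    by case=> [->|->]; rewrite ?eqxx ?orbT.
  by apply/seteqP; split => // w [/= -> h]; rewrite h in rs.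
have := key _ (enum_uniq F); rewrite (_ : _ @^-1` _ = setT).
  by rewrite probability_setT big_enum => -[].
by apply/seteqP; split => // w _ /=; rewrite mem_enum.
Qed.

End Reduction.

Lemma intr_Fp_eq (p : nat) (z : int) (r : 'F_p) : prime p ->
  (z%:~R == r) = (z == Posz r %[mod p])%Z.
Proof.
move=> pp; rewrite eqz_mod_dvd (dvdz_pcharf (pchar_Fp pp)) rmorphB /= subr_eq0.
by rewrite -pmulrn natr_Zp.
Qed.

Lemma balanced_residue (d : measure_display) (T : measurableType d) (R : realType)
    (P : probability T R) (alpha : R) (xi : {RV P >-> int}) (p : nat) (r : 'F_p) :
  balanced P alpha xi -> prime p ->
  (P (xi @^-1` [set z | z%:~R = r]) <= (1 - alpha)%:E)%E.
Proof.
move=> bal pp; have rp : (r < p)%N by rewrite -[X in (_ < X)%N](Fp_cast pp) ltn_ord.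
have := bal p (Ordinal rp) pp; congr (P _ <= _)%E.
apply/seteqP; split => w /= /eqP.
  by move=> h; apply/eqP; rewrite intr_Fp_eq.
by rewrite intr_Fp_eq // => /eqP.
Qed.

(** * The main theorem *)

Lemma Fp_natP (p : nat) (t : 'F_p) : exists k : nat, t = k%:R.
Proof. by exists t; rewrite natr_Zp. Qed.

Section SingularPrime.
Variables (R : realType) (alpha : R) (p : nat) (mu : 'F_p -> R).
Hypotheses (alpha_gt0 : 0 < alpha) (alpha_le1 : alpha <= 1) (two_neq0 : 2 != 0 :> 'F_p).
Hypotheses (mu_ge0 : forall r, 0 <= mu r) (sum_mu : \sum_r mu r = 1).
Hypotheses (mu_le : forall r, mu r <= 1 - alpha) (pp : prime p).
Variables (n : nat) (s : R) (k r e : nat).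
Hypothesis sc : scales alpha #|'F_p| n./2 (n - n./2) s k r e.

Let half_n : (n./2 + (n - n./2) = n)%N.
Proof. by rewrite subnKC //; have [_ _] := half_bounds n; lia. Qed.

Lemma singular_weight_skew : ~~ odd n ->
  \sum_(x in pfamily 0 (below_diag n) (fun=> predT) | \det (skew_matrix x) == 0)
    law_prob mu (below_diag n) x <= (3 + 3 * expR 1) / p%:R.
Proof.
have [co [si chi]] := exists_additive_character R pp.
have := singular_prob_skew chi alpha_gt0 alpha_le1 mu_ge0 sum_mu mu_le two_neq0 (@Fp_natP p) sc.
by rewrite card_Fp // half_n.
Qed.

Lemma singular_weight_sym :
  \sum_(x in pfamily 0 (on_or_below_diag n) (fun=> predT) | \det (sym_matrix x) == 0)
    law_prob mu (on_or_below_diag n) x <= (3 + 3 * expR 1) / p%:R.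
Proof.
have [co [si chi]] := exists_additive_character R pp.
have := singular_prob_sym chi alpha_gt0 alpha_le1 mu_ge0 sum_mu mu_le two_neq0 (@Fp_natP p) sc.
rewrite card_Fp // half_n => /le_trans -> //.
by rewrite ler_wpM2r // lerD2r ler_nat.
Qed.

Lemma singular_weight_laplacian :
  \sum_(x in pfamily 0 (above_diag n.+1) (fun=> predT) | \det (laplacian_matrix x) == 0)
    law_prob mu (above_diag n.+1) x <= (3 + 3 * expR 1) / p%:R.
Proof.
have [co [si chi]] := exists_additive_character R pp.
have := singular_prob_laplacian chi alpha_gt0 alpha_le1 mu_ge0 sum_mu mu_le two_neq0 (@Fp_natP p) sc.
rewrite card_Fp // half_n => /le_trans -> //.
by rewrite ler_wpM2r // lerD2r ler_nat.
Qed.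

End SingularPrime.

Section IntegerEntries.
Variables (d0 : measure_display) (T0 : measurableType d0) (R : realType).
Variables (P0 : probability T0 R) (alpha : R) (xi : {RV P0 >-> int}) (p : nat).
Hypotheses (bal : balanced P0 alpha xi) (pp : prime p).

Definition residue_law (r : 'F_p) : R := fine (P0 (xi @^-1` [set z | z%:~R = r])).

Lemma residue_lawE r : P0 (xi @^-1` [set z | z%:~R = r]) = (residue_law r)%:E.
Proof. by rewrite fineK // fin_num_measure //; apply: measurable_funPTI. Qed.

Lemma residue_law_ge0 r : 0 <= residue_law r.
Proof. exact: fine_ge0. Qed.

Lemma sum_residue_law : \sum_r residue_law r = 1.
Proof. by apply: (@sum_law _ _ _ P0 _ int _ _ (fun z : int => z%:~R) _ xi) => // r; apply: residue_lawE. Qed.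

Lemma residue_law_le r : residue_law r <= 1 - alpha.
Proof. by rewrite -lee_fin -residue_lawE; apply: balanced_residue. Qed.

Variables (d : measure_display) (T : measurableType d) (P : probability T R).

Lemma integer_event_le (K : finType) (D : {pred K}) (X : K -> {RV P >-> int})
    (E : (K -> int) -> Prop) (G : pred {ffun K -> 'F_p}) :
  iid_copies P0 P xi D X ->
  (forall z : K -> int, E z -> G [ffun k => if k \in D then (z k)%:~R else 0]) ->
  (P [set w | E (fun k => X k w)] <=
    (\sum_(x in pfamily 0 D (fun=> predT) | G x) law_prob residue_law D x)%:E)%E.
Proof.
move=> [ind same] EG.
apply: (@event_le_law_prob _ _ _ P _ int _ _ (fun z : int => z%:~R) _ _ _ _ _ _ ind) => //.
- move=> k r kD; rewrite -residue_lawE.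
  exact: (same k kD [set z | z%:~R = r]).
- by apply: measurable_countable_event => k c; apply: measurable_funPTI.
- by move=> w /EG.
Qed.

End IntegerEntries.

Lemma det_skew_mx_Fp (p m : nat) (z : 'I_m * 'I_m -> int) : \det (skew_mx z) = 0 ->
  \det (skew_matrix [ffun k => if k \in below_diag m then (z k)%:~R else 0 : 'F_p]) == 0.
Proof.
move=> h; have -> : skew_matrix [ffun k => if k \in below_diag m then (z k)%:~R else 0 : 'F_p] =
    map_mx intr (skew_mx z).
  apply/matrixP => i j; rewrite !mxE !ffunE !unfold_in /below_diag /=.
  by case: ltngtP; rewrite ?rmorph0 // rmorphN.
by rewrite det_map_mx h rmorph0.
Qed.

Lemma det_sym_mx_Fp (p m : nat) (z : 'I_m * 'I_m -> int) : \det (sym_mx z) = 0 ->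
  \det (sym_matrix [ffun k => if k \in on_or_below_diag m then (z k)%:~R else 0 : 'F_p]) == 0.
Proof.
move=> h; have -> : sym_matrix [ffun k => if k \in on_or_below_diag m then (z k)%:~R else 0 : 'F_p] =
    map_mx intr (sym_mx z).
  apply/matrixP => i j; rewrite !mxE !ffunE !unfold_in /on_or_below_diag /=.
  by case: ltngtP.
by rewrite det_map_mx h rmorph0.
Qed.

Lemma det_reduced_laplacian_Fp (p m : nat) (z : 'I_m.+1 * 'I_m.+1 -> bool) :
  \det (reduced_laplacian z) = 0 ->
  \det (laplacian_matrix [ffun k => if k \in above_diag m.+1 then (z k)%:R else 0 : 'F_p]) == 0.
Proof.
move=> h; have ev (i j : 'I_m.+1) : i != j ->
    edge_value [ffun k => if k \in above_diag m.+1 then (z k)%:R else 0 : 'F_p] i j =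
    (edge z i j)%:~R.
  rewrite -val_eqE /edge_value /edge !ffunE !unfold_in /above_diag /=.
  by case: ltngtP => //= _ _; case: (z _).
have -> : laplacian_matrix [ffun k => if k \in above_diag m.+1 then (z k)%:R else 0 : 'F_p] =
    map_mx intr (reduced_laplacian z).
  apply/matrixP => i j; rewrite !mxE /=; case: eqVneq => [_|ij].
    by rewrite rmorphN rmorph_sum /=; congr (- _); apply: eq_bigr => k ki; apply: ev.
  by apply: ev.
by rewrite det_map_mx h rmorph0.
Qed.

Definition bit_law (R : realType) (p : nat) (r : 'F_p) : R :=
  ((r == 0)%:R + (r == 1)%:R) / 2.

Lemma bit_lawE (d : measure_display) (T : measurableType d) (R : realType)
    (P : probability T R) (X : {RV P >-> bool}) (p : nat) (r : 'F_p) :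
  uniform_bit P X -> P (X @^-1` [set b | b%:R = r]) = (bit_law R r)%:E.
Proof.
move=> unif; rewrite /bit_law.
have [->|r0] := eqVneq r 0.
  rewrite eq_sym oner_eq0 addr0 mul1r -(unif false); congr (P _).
  by apply/seteqP; split => w /=; case: (X w) => //= /eqP; rewrite (oner_eq0 'F_p).
have [->|r1] := eqVneq r 1.
  rewrite add0r mul1r -(unif true); congr (P _).
  by apply/seteqP; split => w /=; case: (X w) => //= /eqP; rewrite eq_sym (oner_eq0 'F_p).
rewrite addr0 mul0r (_ : _ @^-1` _ = set0) ?measure0 //.
apply/seteqP; split => w //=; case: (X w) => /= h; first by case/eqP: r1.
by case/eqP: r0.
Qed.

Lemma sum_bit_law (R : realType) (p : nat) : \sum_(r : 'F_p) bit_law R r = 1.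
Proof.
have h (c : 'F_p) : \sum_r (r == c)%:R = 1 :> R.
  by rewrite (bigD1 c) //= eqxx big1 ?addr0 // => i /negPf ->.
by rewrite -mulr_suml big_split /= !h divff.
Qed.

Lemma bit_law_le (R : realType) (p : nat) (r : 'F_p) : bit_law R r <= 2^-1.
Proof.
rewrite /bit_law -[leRHS]mul1r ler_wpM2r //.
have [->|r0] := eqVneq r 0; first by rewrite eq_sym oner_eq0 addr0.
by rewrite add0r; case: (_ == _).
Qed.

(** For [y < Y] the bound is trivial, since [expR Y * expR (- y)] is then at least one. *)
Lemma bound_small_or_large (R : realType) (x : \bar R) (y Y K : R) : (x <= 1)%E -> 0 <= K ->
  (Y <= y -> (x <= (K * expR (- y))%:E)%E) -> (x <= ((K + expR Y) * expR (- y))%:E)%E.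
Proof.
move=> x1 K0 h; have [/h h1|yY] := leP Y y.
  apply: le_trans h1 _; rewrite lee_fin ler_wpM2r ?expR_ge0 // lerDl expR_ge0 //.
apply: le_trans x1 _; rewrite lee_fin mulrDl -expRD.
have : 1 <= expR (Y - y) by rewrite -expR0 ler_expR subr_ge0 ltW.
have : 0 <= K * expR (- y) by rewrite mulr_ge0 ?expR_ge0.
by lra.
Qed.

Lemma powR_quarter (R : realType) n : (n%:R `^ 4^-1) ^+ 4 = n%:R :> R.
Proof. by rewrite -powR_mulrn ?powR_ge0 // -powRrM mulVf // powRr1. Qed.

Theorem corollary7p18 (R : realType) (alpha : R) (alpha_gt0 : 0 < alpha) :
  exists c : R, 0 < c /\ exists C : R,
  [/\
    forall (d0 : measure_display) (T0 : measurableType d0)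
      (P0 : probability T0 R) (xi : {RV P0 >-> int}), balanced P0 alpha xi ->
    forall (n : nat) (d : measure_display) (T : measurableType d)
      (P : probability T R)
      (x : 'I_(2 * n) * 'I_(2 * n) -> {RV P >-> int}),
      iid_copies P0 P xi (below_diag (2 * n)) x ->
      (P [set w | (\det (skew_mx (fun p => x p w)) = 0)%R]
         <= (C * expR (- (n%:R `^ c)))%:E)%E,
    forall (d0 : measure_display) (T0 : measurableType d0)
      (P0 : probability T0 R) (xi : {RV P0 >-> int}), balanced P0 alpha xi ->
    forall (n : nat) (d : measure_display) (T : measurableType d)
      (P : probability T R)
      (x : 'I_n * 'I_n -> {RV P >-> int}),
      iid_copies P0 P xi (on_or_below_diag n) x ->
      (P [set w | (\det (sym_mx (fun p => x p w)) = 0)%R]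
         <= (C * expR (- (n%:R `^ c)))%:E)%E &
    forall (n : nat) (d : measure_display) (T : measurableType d)
      (P : probability T R)
      (x : 'I_n.+1 * 'I_n.+1 -> {RV P >-> bool}),
      mutually_independent P (above_diag n.+1) x ->
      (forall p, p \in above_diag n.+1 -> uniform_bit P (x p)) ->
      (P [set w | (\det (reduced_laplacian (fun p => x p w)) = 0)%R]
         <= (C * expR (- (n%:R `^ c)))%:E)%E].
Proof.
(* The minimum with [1/2] lets the Laplacian share the constants, as a uniform bit has mass [1/2] at
   two residues; it also gives [a <= 1]. *)
pose a := Num.min alpha 2^-1.
have a_gt0 : 0 < a by rewrite lt_min alpha_gt0 /= invr_gt0.
have a_half : a <= 2^-1 by rewrite ge_min lexx orbT.
have a_le1 : a <= 1.
  by apply: (le_trans a_half); rewrite invf_le1 // ler1n.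
have bal (d0 : measure_display) (T0 : measurableType d0) (P0 : probability T0 R)
    (xi : {RV P0 >-> int}) : balanced P0 alpha xi -> balanced P0 a xi.
  move=> b p r pp; apply: le_trans (b p r pp) _.
  by rewrite lee_fin lerB // ge_min lexx.
have [Y HY] := exists_prime_scales a_gt0 a_le1.
have K0 : 0 <= 3 + 3 * expR 1 :> R by rewrite addr_ge0 // mulr_ge0 // expR_ge0.
have inv (p : nat) (y : R) : expR y <= p%:R ->
    (3 + 3 * expR 1) / p%:R <= (3 + 3 * expR 1) * expR (- y).
  move=> h; rewrite ler_wpM2l // expRN lef_pV2 // posrE ?expR_gt0 //.
  exact: lt_le_trans (expR_gt0 y) h.
exists 4^-1; split; first by rewrite invr_gt0.
exists (3 + 3 * expR 1 + expR Y); split.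
- move=> d0 T0 P0 xi /bal b n d T P x iid.
  have mE : measurable [set w | \det (skew_mx (fun p => x p w)) = 0].
    apply: (@measurable_countable_event _ T _ int x (fun z => \det (skew_mx z) = 0)).
    by move=> k c; apply: measurable_funPTI.
  (* The matrix has size [2 * n], so the bound is first obtained with [2 * n] in place of [n], which
     is stronger. *)
  apply: (@le_trans _ _ ((3 + 3 * expR 1 + expR Y) * expR (- ((2 * n)%:R `^ 4^-1)))%:E).
    apply: bound_small_or_large => //; first exact: probability_le1.
    move=> Yy; have [p [pp two0 yp [s [k [r [e sc]]]]]] := HY _ _ (powR_ge0 _ _) (powR_quarter R _) Yy.
    apply: le_trans (integer_event_le (P := P) (p := p) iid (@det_skew_mx_Fp p _)) _.
    rewrite lee_fin; apply: le_trans (inv _ _ yp).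
    apply: singular_weight_skew sc _ => //.
    + exact: residue_law_ge0.
    + exact: sum_residue_law.
    + exact: residue_law_le b pp.
    + by rewrite mul2n odd_double.
  rewrite lee_fin ler_wpM2l ?addr_ge0 ?expR_ge0 ?mulr_ge0 // ler_expR lerN2.
  by apply: ge0_ler_powR; rewrite ?nnegrE // ler_nat leq_pmull.
- move=> d0 T0 P0 xi /bal b n d T P x iid.
  have mE : measurable [set w | \det (sym_mx (fun p => x p w)) = 0].
    apply: (@measurable_countable_event _ T _ int x (fun z => \det (sym_mx z) = 0)).
    by move=> k c; apply: measurable_funPTI.
  apply: bound_small_or_large => //; first exact: probability_le1.
  move=> Yy; have [p [pp two0 yp [s [k [r [e sc]]]]]] := HY _ _ (powR_ge0 _ _) (powR_quarter R _) Yy.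
  apply: le_trans (integer_event_le (P := P) (p := p) iid (@det_sym_mx_Fp p _)) _.
  rewrite lee_fin; apply: le_trans (inv _ _ yp).
  apply: singular_weight_sym sc => //.
  + exact: residue_law_ge0.
  + exact: sum_residue_law.
  + exact: residue_law_le b pp.
- move=> n d T P x ind unif.
  have mE : measurable [set w | \det (reduced_laplacian (fun p => x p w)) = 0].
    apply: (@measurable_countable_event _ T _ bool x (fun z => \det (reduced_laplacian z) = 0)).
    by move=> k c; apply: measurable_funPTI.
  apply: bound_small_or_large => //; first exact: probability_le1.
  move=> Yy; have [p [pp two0 yp [s [k [r [e sc]]]]]] := HY _ _ (powR_ge0 _ _) (powR_quarter R _) Yy.
  have law k0 (r0 : 'F_p) : k0 \in above_diag n.+1 ->
      P (x k0 @^-1` [set b : bool | b%:R = r0]) = (bit_law R r0)%:E.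
    by move=> /unif; apply: bit_lawE.
  apply: le_trans (event_le_law_prob (P := P) (red := fun b : bool => b%:R : 'F_p)
    (G := fun z => \det (laplacian_matrix z) == 0) _ ind law mE _) _ => //.
    by move=> w; apply: det_reduced_laplacian_Fp.
  rewrite lee_fin; apply: le_trans (inv _ _ yp).
  apply: singular_weight_laplacian sc => //.
  + by move=> z; rewrite divr_ge0 ?addr_ge0.
  + exact: sum_bit_law.
  + by move=> z; apply: le_trans (bit_law_le R z) _; lra.
Qed.
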